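(* Let $\mathtt{k}>0$, $d>0$, $\upsilon>0$, $c\in\mathbb{C}$, let $l$ be real with $l>-\frac{3}{2}\mathtt{k}$, and let $N_0$ be a constant. Then the solution $N(t)$, $t>0$, of the generalized fractional kinetic equation $$N(t)-N_{0}\,\mathtt{S}_{l,c}^{\mathtt{k}}(t)=-d^{\upsilon}\;{}_{0}D_{t}^{-\upsilon}N(t)$$ is given by $$N(t)=N_{0}\sum_{r=0}^{\infty}\frac{(-c)^{r}\,\Gamma\left(2r+\frac{l}{\mathtt{k}}+2\right)}{\Gamma_{\mathtt{k}}\left(r\mathtt{k}+l+\frac{3}{2}\mathtt{k}\right)\Gamma\left(r+\frac{3}{2}\right)}\left(\frac{t}{2}\right)^{2r+\frac{l}{\mathtt{k}}+1}E_{\upsilon,\,2r+\frac{l}{\mathtt{k}}+2}\left(-d^{\upsilon}t^{\upsilon}\right).$$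
   Context: For $\mathtt{k}>0$, $\Gamma_{\mathtt{k}}$ is the $\mathtt{k}$-gamma function $\Gamma_{\mathtt{k}}(x)=\int_0^\infty t^{x-1}e^{-t^{\mathtt{k}}/\mathtt{k}}\,dt=\mathtt{k}^{\frac{x}{\mathtt{k}}-1}\Gamma(x/\mathtt{k})$ for $x>0$. The $\mathtt{k}$-Struve function is $$\mathtt{S}_{\nu,c}^{\mathtt{k}}(x)=\sum_{r=0}^{\infty}\frac{(-c)^r}{\Gamma_{\mathtt{k}}\left(r\mathtt{k}+\nu+\frac{3\mathtt{k}}{2}\right)\Gamma\left(r+\frac{3}{2}\right)}\left(\frac{x}{2}\right)^{2r+\frac{\nu}{\mathtt{k}}+1}.$$ The Riemann-Liouville fractional integral is ${}_{0}D_{t}^{-\upsilon}f(t)=\frac{1}{\Gamma(\upsilon)}\int_{0}^{t}(t-s)^{\upsilon-1}f(s)\,ds$, $\upsilon>0$. The generalized Mittag-Leffler function is $E_{\alpha,\beta}(x)=\sum_{n=0}^{\infty}\frac{x^{n}}{\Gamma(\alpha n+\beta)}$. *)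

(* Defs.v *)
From HB Require Import structures.
From mathcomp Require Import all_boot all_order all_algebra.
From mathcomp Require Import complex.
From mathcomp Require Import all_classical all_reals all_analysis.

Set Implicit Arguments.
Unset Strict Implicit.
Unset Printing Implicit Defensive.

Import Order.TTheory GRing.Theory Num.Theory.
Import numFieldNormedType.Exports.

Local Open Scope classical_set_scope.
Local Open Scope ring_scope.
Local Open Scope complex_scope.

(* The topology of R[i] is the one induced by its norm, i.e. the modulus. *)
HB.instance Definition _ (R : rcfType) :=
  NormedModule.copy R[i] R[i]^o.

Section kinetic.
Context {R : realType}.
Implicit Types (k nu c x t : R).

Local Notation mu := (@lebesgue_measure R).

(* For 0 < x this is Euler's Gamma(x); the integral is Lebesgue's. *)
Definition Gamma x : R :=
  \int[mu]_(t in `]0, +oo[) (t `^ (x - 1) * expR (- t)).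

Definition kGamma k x : R :=
  \int[mu]_(t in `]0, +oo[) (t `^ (x - 1) * expR (- (t `^ k / k))).

Definition mittag_leffler_term (alpha beta x : R) (n : nat) : R :=
  x ^+ n / Gamma (alpha * n%:R + beta).

Definition mittag_leffler (alpha beta x : R) : R :=
  limn (series (mittag_leffler_term alpha beta x)).

Definition kstruve_term k nu (c : R[i]) x (r : nat) : R[i] :=
  (- c) ^+ r
  / (kGamma k (r%:R * k + nu + 3 * k / 2) * Gamma (r%:R + 3 / 2))%:C
  * ((x / 2) `^ (2 * r%:R + nu / k + 1))%:C.

(* Meant for 0 < x, where the real power of x / 2 is the usual one. *)
Definition kstruve k nu (c : R[i]) x : R[i] :=
  limn (series (kstruve_term k nu c x)).

Definition cintegrable (D : set R) (f : R -> R[i]) : Prop :=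
  mu.-integrable D (fun s => (complex.Re (f s))%:E) /\
  mu.-integrable D (fun s => (complex.Im (f s))%:E).

Definition cintegral (D : set R) (f : R -> R[i]) : R[i] :=
  (\int[mu]_(s in D) complex.Re (f s)) +i*
  (\int[mu]_(s in D) complex.Im (f s)).

Definition RL_integrand (upsilon : R) (f : R -> R[i]) t (s : R) : R[i] :=
  ((t - s) `^ (upsilon - 1))%:C * f s.

Definition RL_integral (upsilon : R) (f : R -> R[i]) t : R[i] :=
  ((Gamma upsilon)^-1)%:C * cintegral `]0, t[ (RL_integrand upsilon f t).

(* Only the values of N on the positive half-line matter. The first clause
   makes the Riemann-Liouville integral of N exist (absolutely) at every
   t > 0: [cintegral] has an arbitrary value on non-integrable functions. *)
Definition kinetic_solution k (d upsilon l : R) (c N0 : R[i])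
    (N : R -> R[i]) : Prop :=
  forall t, 0 < t ->
    cintegrable `]0, t[ (RL_integrand upsilon N t) /\
    N t - N0 * kstruve k l c t
      = - (d `^ upsilon)%:C * RL_integral upsilon N t.

Definition solution_term k (d upsilon l : R) (c : R[i]) t (r : nat) : R[i] :=
  (- c) ^+ r * (Gamma (2 * r%:R + l / k + 2))%:C
  / (kGamma k (r%:R * k + l + 3 / 2 * k) * Gamma (r%:R + 3 / 2))%:C
  * ((t / 2) `^ (2 * r%:R + l / k + 1))%:C
  * (mittag_leffler upsilon (2 * r%:R + l / k + 2)
       (- (d `^ upsilon * t `^ upsilon)))%:C.

End kinetic.

(* Main.v *)
Require Import Defs.
From HB Require Import structures.
From mathcomp Require Import all_boot all_order all_algebra.
From mathcomp Require Import complex.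
From mathcomp Require Import all_classical all_reals all_analysis.
From mathcomp Require Import measurable_realfun.
From mathcomp Require Import ring lra.

(** Let I be the Riemann-Liouville integral of order a = upsilon and
lam = d^upsilon, so that the equation reads N + lam I N = N0 S. Euler's Beta
integral gives I (s^(b-1) / Gamma b) = s^(b+a-1) / Gamma (b+a); hence the
Neumann series of (1 + lam I)^-1, applied to s^(b-1), sums to
Gamma b s^(b-1) E_(a,b) (- lam s^a), the mode attached to one power of s.
Adding up the modes of the powers in the k-Struve series gives the stated
solution. Both interchanges of sum and integral are absolutely convergent,
because Gamma b / Gamma (b+y) decreases in b: the first mode bounds all others.

For uniqueness, a solution h of the homogeneous equation is integrable on every
]0, T[, and by Tonelli its L1 norm on ]0, T[ with weight exp (- k s) is at most
lam / k^a times itself. For k large it vanishes, so h = 0 almost everywhere,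
and then everywhere because h (t) is an integral of h. The Beta integral itself
follows from the same convolution identity applied to two Gamma densities. *)

Set Implicit Arguments.
Unset Strict Implicit.
Unset Printing Implicit Defensive.

Import Order.TTheory GRing.Theory Num.Theory.
Import numFieldNormedType.Exports.

Local Open Scope classical_set_scope.
Local Open Scope ring_scope.
Local Open Scope complex_scope.

(** * Convolutions and power functions *)

Section affine_and_powers.
Context {R : realType}.
Local Notation mu := (@lebesgue_measure R).
(** Push [mu] forward along [x |-> a * x + b] and scale by [a]: the result agrees with [mu] on
    half-open intervals, hence everywhere by uniqueness of Lebesgue measure. *)
Lemma ge0_integral_affine (a b : R) (f : R -> \bar R) : 0 < a ->
  measurable_fun setT f -> (forall x, 0 <= f x)%E ->
  (\int[mu]_x f (a * x + b)%R = a^-1%:E * \int[mu]_x f x)%E.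
Proof.
move=> a0 mf f0.
pose phi : measurableTypeR R -> measurableTypeR R := fun x => a * x + b.
have mphi : measurable_fun setT phi.
  by apply: measurable_funD => //; exact: measurable_funM.
have := @ge0_integral_pushforward _ _ _ _ R _ mphi mu setT f measurableT mf
  (fun x _ => f0 x).
rewrite preimage_setT => <-.
have a0' : 0 <= a by exact: ltW.
pose nu : {measure set (measurableTypeR R) -> \bar R} := pushforward mu phi.

pose m : {measure set (measurableTypeR R) -> \bar R} := mscale (NngNum a0') (nu mphi).
have mE A : measurable A -> mu A = m A.
  apply: lebesgue_measure_unique => _ [[p q] _ <-].
  rewrite /m /= /mscale /= /pushforward.
  have -> : phi @^-1` [set` Interval (BRight p) (BRight q)]
     = [set` Interval (BRight ((p - b) / a)) (BRight ((q - b) / a))].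
    apply/seteqP; split => x /=; rewrite !in_itv/= ltr_pdivrMr// ler_pdivlMr//
      ltrBlDr lerBrDr mulrC//.
  rewrite !lebesgue_measure_itv /= !lte_fin ltr_pM2r ?invr_gt0// ltrD2r.
  case: ifPn => _; last by rewrite mule0.
  by rewrite -!EFinB -EFinM; congr EFin; field; rewrite gt_eqF.
rewrite [X in (_ = _ * X)%E](_ : _ = \int[m]_x f x)%E; last first.
  by apply: eq_measure_integral => A mA _; exact: mE.
by rewrite ge0_integral_mscale//= muleA -EFinM mulVf ?gt_eqF// mul1e.
Qed.

(** Tonelli exchanges the integrals, and translation invariance then removes [s] from the inner
    one. *)
Lemma ge0_integral_convolution (f g : R -> \bar R) :
  measurable_fun setT f -> (forall x, 0 <= f x)%E ->
  measurable_fun setT g -> (forall x, 0 <= g x)%E ->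
  (\int[mu]_t \int[mu]_s (f (t - s)%R * g s) =
   \int[mu]_x f x * \int[mu]_x g x)%E.
Proof.
move=> mf f0 mg g0.
have m2 : measurable_fun setT (fun z : R * R => f (z.1 - z.2)%R * g z.2)%E.
  apply: emeasurable_funM.
    apply: measurableT_comp => //; apply: measurable_funB.
      exact: measurable_fst.
    exact: measurable_snd.
  by apply: measurableT_comp => //; exact: measurable_snd.
transitivity (\int[mu]_s \int[mu]_t (f (t - s)%R * g s))%E.
  apply: (@fubini_tonelli _ _ _ _ _ mu mu
    (fun z : R * R => f (z.1 - z.2)%R * g z.2)%E m2).
  by move=> x; rewrite mule_ge0.
rewrite -ge0_integralZl//; last exact: integral_ge0.
apply: eq_integral => s _.
rewrite ge0_integralZr//; last first.
  by apply: measurableT_comp => //; exact: measurable_funB.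
congr (_ * _)%E.
have := ge0_integral_affine (- s) (@ltr01 R) mf f0.
by rewrite invr1 mul1e => <-; apply: eq_integral => x _; rewrite mul1r.
Qed.

Lemma measurable_powR_comp (h : R -> R) (p : R) (D : set R) :
  measurable D -> measurable_fun D h -> measurable_fun D (fun x => h x `^ p).
Proof.
by move=> mD mh; exact: (measurableT_comp (measurable_powR p) mh).
Qed.

Lemma continuous_powR (p x : R) : 0 < x -> {for x, continuous (fun y : R => y `^ p)}.
Proof.
move=> x0; apply: differentiable_continuous; apply/derivable1_diffP.
by apply: derivable_powR; rewrite in_itv/= andbT.
Qed.

Lemma integral_powR_itv (a e : R) : 0 < a -> 0 < e -> e < 1 ->
  (\int[mu]_(t in `[e, 1%R]) (t `^ (a - 1)%R)%:E = ((1 - e `^ a) / a)%:E)%E.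
Proof.
move=> a0 e0 e1.
rewrite (@continuous_FTC2 _ _ (fun t => a^-1 * t `^ a))//=.
- by rewrite -EFinB; congr EFin; rewrite powR1; ring.
- apply: continuous_in_subspaceT => x; rewrite inE/= in_itv/= => /andP[ex _].
  by apply: continuous_powR; exact: lt_le_trans ex.
- split.
  + move=> x; rewrite in_itv/= => /andP[ex _].
    apply: derivableM => //; apply: derivable_powR.
    by rewrite in_itv/= andbT (lt_trans _ ex).
  + apply: cvg_at_right_filter; apply: cvgM; first exact: cvg_cst.
    exact: continuous_powR.
  + apply: cvg_at_left_filter; apply: cvgM; first exact: cvg_cst.
    exact: continuous_powR.
- move=> x; rewrite in_itv/= => /andP[ex _].
  have x0 : 0 < x by exact: lt_trans ex.
  have /= dx := is_derive1_powR a x0.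
  rewrite derive1E deriveM//= derive_val derive_cst scaler0 addr0.
  by rewrite /GRing.scale/= mulrA mulVf ?mul1r// gt_eqF.
Qed.

(** Monotone convergence along intervals that avoid the possible singularity at 0; each integral is
    at most [1 / a]. *)
Lemma integral_powR_01_lty (a : R) : 0 < a ->
  (\int[mu]_(t in `]0%R, 1%R]) (t `^ (a - 1)%R)%:E < +oo)%E.
Proof.
move=> a0.
(* The shift by 2 makes the left endpoint strictly less than 1 from [n = 0] on, as
   [integral_powR_itv] requires. *)
pose F (n : nat) := `[n.+2%:R^-1 : R, 1]%classic.
have FE : `]0 : R, 1]%classic = \bigcup_n F n.
  apply/seteqP; split => x /=.
    rewrite in_itv/= => /andP[x0 x1]; exists (Num.truncn (x^-1)) => //=.
    rewrite /F/= in_itv/= x1 andbT invf_ple ?posrE//.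
    apply/ltW/(lt_trans (truncnS_gt _)); rewrite ltr_nat//.
  move=> [n _]; rewrite /F/= !in_itv/= => /andP[nx ->]; rewrite andbT.
  exact: lt_le_trans nx.
apply: (@le_lt_trans _ _ (a^-1)%:E); last exact: ltry.
rewrite FE; have H : (\int[mu]_(t in F n) (t `^ (a - 1)%R)%:E @[n --> \oo] -->
    \int[mu]_(t in \bigcup_n F n) (t `^ (a - 1)%R)%:E)%E.
  apply: ge0_nondecreasing_set_cvg_integral.
  - move=> m n mn; apply/subsetPset => x; rewrite /F/= !in_itv/= => /andP[mx ->].
    rewrite andbT (le_trans _ mx)// lef_pV2 ?posrE// ler_nat ltnS.
    exact: leq_trans mn _.
  - by move=> i; exact: measurable_itv.
  - by move=> i; apply/measurable_EFinP; exact: measurable_funTS.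
  - by move=> i x _; rewrite lee_fin powR_ge0.
apply: cvge_le H; apply: nearW => n.
rewrite integral_powR_itv// ?lee_fin ?invr_gt0//.
  by rewrite ler_pdivrMr// mulVf ?gt_eqF// gerBl powR_ge0.
by rewrite invf_lt1// ltr1n.
Qed.
End affine_and_powers.

(** * The Gamma function *)

Section gamma.
Context {R : realType}.
Local Notation mu := (@lebesgue_measure R).

Lemma integral_patch (f : R -> R) (D : set R) :
  (\int[mu]_x ((f \_ D) x)%:E = \int[mu]_(x in D) (f x)%:E)%E.
Proof.
by rewrite [in RHS]integral_mkcond; apply: eq_integral => x _; rewrite restrict_EFin.
Qed.

Lemma powRB1_div (a x : R) : 0 < x -> x `^ (a - 1) = x `^ a / x.
Proof.
by move=> x0; rewrite powRB ?powRr1 ?(ltW x0)// (gt_eqF x0) implybT.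
Qed.

(** Unnormalised Gamma density of shape [a] and rate [c]. Extension by zero turns convolutions over
    the whole line into integrals over []0, t[]. *)
Definition gamma_kernel (a c : R) : R -> R :=
  (fun x => x `^ (a - 1) * expR (- (c * x))) \_ `]0, +oo[.

Lemma gamma_kernelE a c x : 0 < x ->
  gamma_kernel a c x = x `^ (a - 1) * expR (- (c * x)).
Proof. by move=> x0; rewrite /gamma_kernel patchE mem_set//= in_itv/= x0. Qed.

Lemma gamma_kernel_le0 a c x : x <= 0 -> gamma_kernel a c x = 0.
Proof.
by move=> x0; rewrite /gamma_kernel patchE memNset//= in_itv/= andbT ltNge x0.
Qed.

Lemma gamma_kernel_ge0 a c x : 0 <= gamma_kernel a c x.
Proof.
have [x0|x0] := leP x 0; first by rewrite gamma_kernel_le0.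
by rewrite gamma_kernelE// mulr_ge0 ?powR_ge0 ?expR_ge0.
Qed.

Lemma measurable_gamma_kernel a c : measurable_fun setT (gamma_kernel a c).
Proof.
apply/(measurable_restrictT _ _).1; first exact: measurable_itv.
apply: measurable_funTS; apply: measurable_funM => //.
apply: measurableT_comp => //; apply: measurableT_comp => //.
Qed.

(** This is [ln y <= y] at [y = t / (2 * a)], multiplied by [a] and exponentiated. *)
Lemma powR_le_expR (a t : R) : 0 < a -> 0 < t ->
  t `^ a <= (2 * a) `^ a * expR (t / 2).
Proof.
move=> a0 t0; have a20 : 0 < 2 * a by rewrite mulr_gt0.
have -> : t `^ a = (2 * a) `^ a * (t / (2 * a)) `^ a.
  by rewrite -powRM ?ltW ?divr_gt0// mulrCA divff ?mulr1 ?gt_eqF.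
rewrite ler_pM2l ?powR_gt0// /powR gt_eqF ?divr_gt0// ler_expR.
rewrite (_ : _ / 2 = a * (t / (2 * a))); last first.
  by field; rewrite gt_eqF.
by rewrite ler_pM2l//; apply/ltW/ln_sublinear; rewrite divr_gt0.
Qed.

Lemma integral_gamma_kernel1_lty (a : R) : 0 < a ->
  (\int[mu]_x (gamma_kernel a 1 x)%:E < +oo)%E.
Proof.
move=> a0.
(* [h1] dominates up to 1 and [h2] beyond; the factor 2 in [h2] cancels the rate 1/2 of the
   exponential density. *)
pose h1 : R -> R := (fun t => t `^ (a - 1)) \_ `]0, 1].
pose h2 : R -> R := fun t => (2 * a) `^ a * 2 * exponential_pdf 2^-1 t.
have mh1 : measurable_fun setT h1.
  apply/(measurable_restrictT _ _).1; first exact: measurable_itv.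
  exact: measurable_funTS.
have h10 x : 0 <= h1 x by apply: restrict_ge0 => y _; exact: powR_ge0.
have h20 x : 0 <= h2 x.
  by rewrite mulr_ge0 ?mulr_ge0 ?powR_ge0// exponential_pdf_ge0// invr_ge0.
have me : measurable_fun setT (exponential_pdf (2^-1 : R)).
  exact: measurable_exponential_pdf.
have mh2 : measurable_fun setT h2 by exact: measurable_funM.
apply: (@le_lt_trans _ _ (\int[mu]_x ((h1 x)%:E + (h2 x)%:E))%E).
  apply: ge0_le_integral => //=.
  - by move=> x _; rewrite lee_fin gamma_kernel_ge0.
  - by apply/measurable_EFinP; exact: measurable_gamma_kernel.
  - by apply: emeasurable_funD; apply/measurable_EFinP.
  - move=> x _; rewrite -EFinD lee_fin.
    have [x0|x0] := leP x 0; first by rewrite gamma_kernel_le0// addr_ge0.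
    rewrite gamma_kernelE// mul1r.
    have [x1|x1] := leP x 1.
      rewrite (@le_trans _ _ (h1 x)) ?lerDl// /h1 patchE mem_set/=; last first.
        by rewrite in_itv/= x0.
      by rewrite ler_piMr ?powR_ge0// expR_le1 oppr_le0 ltW.
    rewrite (@le_trans _ _ (h2 x)) ?lerDr// /h2.
    have -> : exponential_pdf 2^-1 x = 2^-1 * expR (- 2^-1 * x).
      by rewrite exponential_pdfE// ltW.
    rewrite -mulrA (mulrA 2) divff ?mul1r ?pnatr_eq0//.
    rewrite powRB1_div//.
    have xa : x `^ a / x <= (2 * a) `^ a * expR (x / 2).
      apply: le_trans (powR_le_expR a0 x0).
      by rewrite ler_piMr ?powR_ge0// invf_le1// ltW.
    apply: (@le_trans _ _ ((2 * a) `^ a * expR (x / 2) * expR (- x))).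
      by rewrite ler_wpM2r ?expR_ge0.
    rewrite -mulrA ler_wpM2l ?powR_ge0// -expRD ler_expR.
    lra.
rewrite ge0_integralD//=; [|by move=> x _; rewrite lee_fin..|
  exact/measurable_EFinP|by move=> x _; rewrite lee_fin|exact/measurable_EFinP].
rewrite lte_add_pinfty//.
  by rewrite integral_patch; exact: integral_powR_01_lty.
rewrite /h2; under eq_integral do rewrite EFinM.
rewrite ge0_integralZl//=.
- by rewrite integral_exponential_pdf ?mule1 ?ltry// invr_gt0.
- exact/measurable_EFinP.
- by move=> x _; rewrite lee_fin exponential_pdf_ge0// invr_ge0.
- by rewrite lee_fin mulr_ge0 ?powR_ge0.
Qed.

Lemma integral_gamma_kernel (a c : R) : 0 < a -> 0 < c ->
  (\int[mu]_x (gamma_kernel a c x)%:E = (Gamma a / c `^ a)%:E)%E.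
Proof.
move=> a0 c0.
(* [Gamma] is the real part of an extended integral, so finiteness is what makes the two agree. *)
have H1 : (\int[mu]_x (gamma_kernel a 1 x)%:E = (Gamma a)%:E)%E.
  have E : (\int[mu]_x (gamma_kernel a 1 x)%:E =
      \int[mu]_(t in `]0%R, +oo[) (t `^ (a - 1) * expR (- t))%:E)%E.
    by rewrite integral_patch; apply: eq_integral => x _; rewrite mul1r.
  rewrite /Gamma /Rintegral -E.
  rewrite fineK// ge0_fin_numE ?integral_gamma_kernel1_lty//.
  by apply: integral_ge0 => x _; rewrite lee_fin gamma_kernel_ge0.
have := @ge0_integral_affine R c 0 (EFin \o gamma_kernel a 1) c0.
rewrite /= H1 => H2.
transitivity ((c `^ (1 - a))%:E * \int[mu]_x (gamma_kernel a 1 (c * x + 0)%R)%:E)%E.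
  rewrite -ge0_integralZl//=.
  - apply: eq_integral => x _; rewrite -EFinM; congr EFin.
    rewrite addr0; have [x0|x0] := leP x 0.
      by rewrite !gamma_kernel_le0 ?mulr0// pmulr_rle0.
    rewrite !gamma_kernelE ?mulr_gt0// powRM ?ltW// mul1r !mulrA -powRD.
      by rewrite (_ : 1 - a + (a - 1) = 0) ?powRr0 ?mul1r//; ring.
    by rewrite (gt_eqF c0) implybT.
  - apply/measurable_EFinP.
    apply: (measurableT_comp (measurable_gamma_kernel a 1)).
    by apply: measurable_funD => //; exact: measurable_funM.
  - by move=> x _; rewrite lee_fin gamma_kernel_ge0.
  - by rewrite lee_fin powR_ge0.
rewrite H2.
- rewrite -!EFinM; congr EFin.
  rewrite powRB ?(gt_eqF c0) ?implybT// powRr1 ?ltW//.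
  by field; rewrite !gt_eqF// powR_gt0.
- by apply/measurable_EFinP; exact: measurable_gamma_kernel.
- by move=> x; rewrite lee_fin gamma_kernel_ge0.
Qed.

(** Keep only the part of the integral over [[A, A + 1]]. Writing the power as [t^a / t] gives a
    lower bound whatever the sign of [a - 1]. *)
Lemma le_integral_powR_weight (a A m : R) (w : R -> R) : 0 <= a -> 0 < A ->
  measurable_fun setT w -> (forall t, 0 <= w t) -> 0 <= m ->
  (forall t, A <= t <= A + 1 -> m <= w t) ->
  ((A `^ a / (A + 1) * m)%:E <=
   \int[mu]_(t in `]0%R, +oo[) (t `^ (a - 1)%R * w t)%:E)%E.
Proof.
move=> a0 A0 mw w0 m0 mlew.
have mf : measurable_fun setT (fun t => (t `^ (a - 1)%R * w t)%:E).
  by apply/measurable_EFinP; exact: measurable_funM.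
apply: (@le_trans _ _ (\int[mu]_(t in `[A, (A + 1)%R])
    (t `^ (a - 1)%R * w t)%:E)%E); last first.
  apply: ge0_subset_integral => //=.
  - exact: measurable_funTS.
  - by move=> x _; rewrite lee_fin mulr_ge0 ?powR_ge0.
  - move=> x /=; rewrite !in_itv/= => /andP[Ax _]; rewrite andbT.
    exact: lt_le_trans Ax.
apply: (@le_trans _ _ (\int[mu]_(t in `[A, (A + 1)%R])
    cst (A `^ a / (A + 1) * m)%:E t)%E).
  rewrite integral_cst//= lebesgue_measure_itv/= lte_fin ltrDl ltr01.
  by rewrite -EFinB addrAC subrr add0r mule1.
have c0 : 0 <= A `^ a / (A + 1).
  by rewrite divr_ge0 ?powR_ge0// addr_ge0// ltW.
apply: ge0_le_integral => //=.
- by move=> t _; rewrite lee_fin mulr_ge0.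
- exact: measurable_funTS.
move=> t; rewrite in_itv/= => /andP[At tA]; rewrite lee_fin.
have t0 : 0 < t by exact: lt_le_trans At.
apply: ler_pM => //; last by apply: mlew; rewrite At.
rewrite powRB1_div// ler_pM ?powR_ge0 ?invr_ge0 ?addr_ge0 ?(ltW A0)//.
  by apply: ge0_ler_powR => //; rewrite nnegrE ltW.
by rewrite lef_pV2 ?posrE// addr_gt0.
Qed.

(** As [A] is arbitrary, Gamma outgrows every geometric sequence; this drives the convergence of the
    Mittag-Leffler series. *)
Lemma Gamma_lower (a A : R) : 0 < a -> 0 < A ->
  A `^ a / (A + 1) * expR (- (A + 1)) <= Gamma a.
Proof.
move=> a0 A0; have := integral_gamma_kernel a0 ltr01.
rewrite powR1 divr1 -lee_fin => <-.
rewrite integral_patch.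
under eq_integral do rewrite mul1r.
apply: (@le_integral_powR_weight _ _ _ (fun t => expR (- t))) => //.
- exact: ltW.
- by apply: measurableT_comp => //; exact: measurableT_comp.
- by move=> t /andP[_ ?]; rewrite ler_expR lerN2.
Qed.

Lemma Gamma_gt0 (a : R) : 0 < a -> 0 < Gamma a.
Proof.
move=> a0; apply: lt_le_trans (Gamma_lower a0 ltr01).
by rewrite mulr_gt0 ?expR_gt0// divr_gt0 ?powR_gt0// addr_gt0.
Qed.

(* The k-Gamma integral is only bounded below: if it diverged, [kGamma] would
   be the junk value 0, whose inverse is again 0. *)
Lemma kGammaV_bounded (k : R) : 0 < k ->
  exists2 C : R, 0 < C & forall x, 0 < x -> `|(kGamma k x)^-1| <= C.
Proof.
(* [m] is the least value of the weight on [[1, 2]], the interval obtained from [A = 1]. *)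
move=> k0; pose m : R := expR (- (2 `^ k / k)).
exists (2 / m) => [|x x0]; first by rewrite divr_gt0 ?expR_gt0.
pose w : R -> R := fun t => expR (- (t `^ k / k)).
have I : ((m / 2)%:E <= \int[mu]_(t in `]0%R, +oo[) (t `^ (x - 1)%R * w t)%:E)%E.
  have := @le_integral_powR_weight x 1 m w (ltW x0) ltr01.
  rewrite powR1 div1r mulrC; apply.
  - apply: measurableT_comp => //; apply: measurableT_comp => //.
    exact: measurable_funM.
  - by move=> t; exact: expR_ge0.
  - exact: expR_ge0.
  - move=> t /andP[t1 t2]; rewrite ler_expR lerN2 ler_pM2r ?invr_gt0//.
    have t0 : 0 < t by exact: lt_le_trans t1.
    by apply: ge0_ler_powR; rewrite ?nnegrE ?(ltW k0) ?(ltW t0)//; lra.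
have m0 : 0 < m / 2 by rewrite divr_gt0// expR_gt0.
rewrite /kGamma /Rintegral; move: I.
case: (integral _ _ _) => [r|_|] /=.
- rewrite lee_fin => mr.
  have r0 : 0 < r by exact: lt_le_trans mr.
  rewrite gtr0_norm ?invr_gt0// -[leRHS]invrK invf_div lef_pV2//.
- by rewrite invr0 normr0 divr_ge0// expR_ge0.
- by [].
Qed.
End gamma.

(* Otherwise failed unifications unfold [Gamma] down to Lebesgue integrals. *)
Local Opaque Gamma kGamma.

(** * Euler's Beta integral and the monotonicity of Gamma ratios *)

Section beta.
Context {R : realType}.
Local Notation mu := (@lebesgue_measure R).

Lemma measurable_RL_kernel (a t : R) (D : set R) :
  measurable_fun D (fun s => (t - s) `^ (a - 1)).
Proof.
apply: measurable_funTS; apply: measurable_powR_comp => //.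
exact: measurable_funB.
Qed.

Lemma measurable_RL_powR (a b t : R) (D : set R) :
  measurable_fun D (fun s => (t - s) `^ (a - 1) * s `^ (b - 1)).
Proof.
apply: measurable_funM; first exact: measurable_RL_kernel.
exact: measurable_funTS.
Qed.

(** Extended real, since finiteness is known only once the value has been computed. *)
Let beta (a b : R) : \bar R :=
  (\int[mu]_(u in `]0%R, 1%R[) ((1 - u) `^ (a - 1) * u `^ (b - 1))%R%:E)%E.

Let beta_ge0 a b : (0 <= beta a b)%E.
Proof. by apply: integral_ge0 => x _; rewrite lee_fin mulr_ge0 ?powR_ge0. Qed.

(** Substitution [s = t * u]. *)
Let RL_powR_beta (a b t : R) : 0 < t ->
  (\int[mu]_(s in `]0%R, t[) ((t - s) `^ (a - 1) * s `^ (b - 1))%R%:E =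
   (t `^ (a + b - 1))%:E * beta a b)%E.
Proof.
move=> t0; rewrite /beta.
pose H (T : R) : R -> R :=
  (fun s => (T - s) `^ (a - 1) * s `^ (b - 1)) \_ `]0, T[.
have mH T : measurable_fun setT (EFin \o H T).
  apply/measurable_EFinP/(measurable_restrictT _ _).1; first exact: measurable_itv.
  exact: measurable_RL_powR.
have H0 T x : (0 <= (EFin \o H T) x)%E.
  by rewrite lee_fin; apply: restrict_ge0 => y _; rewrite mulr_ge0 ?powR_ge0.
have := ge0_integral_affine 0 t0 (mH t) (H0 t).
have HE T : (\int[mu]_(s in `]0%R, T[) ((T - s) `^ (a - 1) * s `^ (b - 1))%R%:E =
    \int[mu]_x (H T x)%:E)%E by rewrite integral_patch.
rewrite /= !HE.
have -> : (\int[mu]_x (H t (t * x + 0)%R)%:E =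
    (t `^ (a + b - 1 - 1))%:E * \int[mu]_x (H 1 x)%:E)%E.
  rewrite -ge0_integralZl//=; [|exact: mH|by move=> x _; exact: H0|
    by rewrite lee_fin powR_ge0].
  apply: eq_integral => x _; rewrite -EFinM addr0; congr EFin.
  rewrite /H !patchE.
  have -> : (t * x \in `]0, t[%classic) = (x \in `]0 : R, 1[%classic).
    have tx : (t * x < t) = (x < 1) by rewrite -[X in _ < X](mulr1 t) ltr_pM2l.
    by apply/idP/idP; rewrite !inE/= !in_itv/= pmulr_rgt0// tx.
  case: ifPn; last by rewrite mulr0.
  rewrite inE/= in_itv/= => /andP[x0 x1].
  rewrite -[X in X - t * x]mulr1 -mulrBr !powRM ?subr_ge0 ?ltW// mulrACA.
  rewrite -powRD ?(gt_eqF t0) ?implybT//.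
  by congr (_ `^ _ * _); ring.
have -> : t `^ (a + b - 1) = t * t `^ (a + b - 1 - 1).
  by rewrite (powRB1_div (a + b - 1) t0) mulrCA divff ?mulr1 ?gt_eqF.
by rewrite EFinM -muleA => ->; rewrite muleA -EFinM divff ?gt_eqF// mul1e.
Qed.

(** The convolution of the kernels of shapes [a] and [b] is [beta a b] times the kernel of shape
    [a + b]; comparing total masses gives [Gamma a * Gamma b = Gamma (a + b) * beta a b]. *)
Lemma integral_RL_powR (a b t : R) : 0 < a -> 0 < b -> 0 < t ->
  (\int[mu]_(s in `]0%R, t[) ((t - s) `^ (a - 1) * s `^ (b - 1))%R%:E =
   (t `^ (a + b - 1) * (Gamma a * Gamma b / Gamma (a + b)))%:E)%E.
Proof.
move=> a0 b0 t0; have ab0 : 0 < a + b by exact: addr_gt0.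
rewrite RL_powR_beta// EFinM; congr (_ * _)%E.
have mk (c : R) : measurable_fun setT (EFin \o gamma_kernel c 1).
  by apply/measurable_EFinP; exact: measurable_gamma_kernel.
have k0 c x : (0 <= (EFin \o gamma_kernel c (1 : R)) x)%E.
  by rewrite lee_fin gamma_kernel_ge0.
have := ge0_integral_convolution (mk a) (k0 a) (mk b) (k0 b).
rewrite /= !integral_gamma_kernel// !powR1 !divr1.
(* For [T > 0] the exponentials multiply to [exp (- T)], which does not depend on [s]; for [T <= 0]
   one of the two kernels always vanishes. *)
under eq_integral => T _.
  rewrite (_ : (\int[_]_s _)%E = (gamma_kernel (a + b) 1 T)%:E * beta a b)%E.
    over.
  have [T0|T0] := leP T 0.
    rewrite gamma_kernel_le0// mul0e integral0_eq// => s _.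
    have [s0|s0] := leP s 0; first by rewrite (gamma_kernel_le0 _ _ s0) mule0.
    by rewrite gamma_kernel_le0 ?mul0e// subr_le0 (le_trans T0)// ltW.
  rewrite gamma_kernelE// mul1r mulrC EFinM -muleA -RL_powR_beta//.
  rewrite -ge0_integralZl//=; last 2 first.
    by apply/measurable_EFinP; exact: measurable_RL_powR.
    by move=> s _; rewrite lee_fin mulr_ge0 ?powR_ge0.
  rewrite [RHS]integral_mkcond; apply: eq_integral => s _.
  rewrite patchE -EFinM; case: ifPn => [|].
    rewrite inE/= in_itv/= => /andP[s0 sT].
    rewrite !gamma_kernelE ?subr_gt0// -EFinM; congr EFin.
    rewrite mulrACA [RHS]mulrC; congr (_ * _).
    by rewrite -expRD; congr expR; ring.
  move=> sT; congr EFin; have [s0|s0] := leP s 0.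
    by rewrite (gamma_kernel_le0 _ _ s0) mulr0.
  rewrite gamma_kernel_le0 ?mul0r// subr_le0 leNgt; apply: contra sT => sT.
  by rewrite inE/= in_itv/= s0.
rewrite ge0_integralZr//; [|exact: (mk (a + b))|by move=> x _; exact: (k0 (a + b))].
rewrite integral_gamma_kernel// powR1 divr1 => E.
have G0 : Gamma (a + b) != 0 by rewrite gt_eqF ?Gamma_gt0.
by rewrite EFinM EFinM -E muleAC -EFinM divff// mul1e.
Qed.

(** Up to the factor [Gamma y] both sides are Beta integrals over []0, 1[], where [s^(c - 1)]
    decreases in [c]. *)
Lemma Gamma_ratio_le (b0 b y : R) : 0 < b0 -> b0 <= b -> 0 < y ->
  Gamma b / Gamma (y + b) <= Gamma b0 / Gamma (y + b0).
Proof.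
move=> b00 b0b y0; have bb0 : 0 < b by exact: lt_le_trans b0b.
have E c : 0 < c ->
    (\int[mu]_(s in `]0%R, 1%R[) ((1 - s) `^ (y - 1) * s `^ (c - 1))%R%:E =
     (Gamma y * (Gamma c / Gamma (y + c)))%:E)%E.
  by move=> c0; rewrite integral_RL_powR// powR1 mul1r mulrA.
rewrite -(ler_pM2l (Gamma_gt0 y0)) -lee_fin -(E _ bb0) -(E _ b00).
apply: ge0_le_integral => //=.
- by move=> x _; rewrite lee_fin mulr_ge0 ?powR_ge0.
- by apply/measurable_EFinP; exact: measurable_RL_powR.
- by apply/measurable_EFinP; exact: measurable_RL_powR.
- move=> x; rewrite in_itv/= => /andP[x0 x1]; rewrite lee_fin.
  rewrite ler_wpM2l ?powR_ge0//; apply: ger_powR; first by rewrite x0 ltW.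
  by rewrite lerD2r.
Qed.
End beta.

(** * Termwise integration of series *)

Section termwise.
Context d (T : measurableType d) (R : realType).
Variables (mu : {measure set T -> \bar R}) (D : set T) (mD : measurable D).
Variables (f : nat -> T -> R) (F : T -> R) (m : nat -> R).
Hypothesis mf : forall n, measurable_fun D (f n).
Hypothesis fF : forall x, D x -> series (f ^~ x) @ \oo --> F x.
Hypothesis intf : forall n, (\int[mu]_(x in D) `|f n x|%:E <= (m n)%:E)%E.
Hypothesis cm : cvgn (series m).

(** The dominating function, extended real so that it makes sense at every point; its integral is
    bounded by the sum of [m]. *)
Let g x : \bar R := (\sum_(n <oo) `|f n x|%:E)%E.

Let m0 n : 0 <= m n.
Proof. by rewrite -lee_fin; apply: le_trans (intf n); exact: integral_ge0. Qed.

Let mabs n : measurable_fun D (fun x => `|f n x|%:E).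
Proof. by apply/measurable_EFinP; exact: measurableT_comp. Qed.

Let mg : measurable_fun D g.
Proof. exact: (@ge0_emeasurable_sum _ _ _ _ _ predT). Qed.

Let intg : (\int[mu]_(x in D) g x <= (limn (series m))%:E)%E.
Proof.
rewrite /g integral_nneseries//; apply: lime_le.
  by apply: is_cvg_nneseries => n _ _; exact: integral_ge0.
apply: nearW => n; apply: (@le_trans _ _ (\sum_(0 <= i < n) (m i)%:E)%E).
  exact: lee_sum.
rewrite sumEFin lee_fin; apply: (nondecreasing_cvgn_le _ cm n).
by apply: nondecreasing_series => i _ _; exact: m0.
Qed.

Let g0 x : (0 <= g x)%E.
Proof. by apply: nneseries_ge0 => n _ _; rewrite lee_fin. Qed.

Let series_le n x : (`|series (f ^~ x) n|%:E <= g x)%E.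
Proof.
apply: (@le_trans _ _ (\sum_(0 <= i < n) `|f i x|%:E)%E).
  by rewrite sumEFin lee_fin; exact: ler_norm_sum.
by apply: nneseries_lim_ge => i _ _; rewrite lee_fin.
Qed.

Let F_le x : D x -> (`|F x|%:E <= g x)%E.
Proof.
move=> Dx.
have H : (`|series (f ^~ x) n|%:E @[n --> \oo] --> `|F x|%:E)%E.
  by apply: cvg_EFin; [exact: nearW|exact: cvg_norm (fF Dx)].
by apply: cvge_le H; apply: nearW => n; exact: series_le.
Qed.

Let mF : measurable_fun D F.
Proof.
apply: (@measurable_fun_cvg _ _ _ _ (fun n x => series (f ^~ x) n)) => //.
move=> n; apply: measurable_sum => i; exact: mf.
Qed.

Lemma integral_abs_series_le :
  (\int[mu]_(x in D) `|F x|%:E <= (limn (series m))%:E)%E.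
Proof.
apply: le_trans intg; apply: ge0_le_integral => //.
by apply/measurable_EFinP; exact: measurableT_comp.
Qed.

Lemma integrable_series : mu.-integrable D (EFin \o F).
Proof.
apply/integrableP; split; first exact/measurable_EFinP.
by apply: le_lt_trans integral_abs_series_le _; exact: ltry.
Qed.

(** Dominated convergence for the partial sums, with [g] as bound. *)
Lemma cvg_series_Rintegral :
  series (fun n => \int[mu]_(x in D) f n x) @ \oo --> \int[mu]_(x in D) F x.
Proof.
have If n : mu.-integrable D (EFin \o f n).
  apply/integrableP; split; first exact/measurable_EFinP.
  by apply: le_lt_trans (intf n) _; exact: ltry.
have Ig : mu.-integrable D g.
  apply/integrableP; split => //.
  under eq_integral do rewrite gee0_abs//.
  by apply: le_lt_trans intg _; exact: ltry.
have [|||| _ _ H] := @dominated_convergence _ _ _ mu D mD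
  (fun n x => (series (f ^~ x) n)%:E) (EFin \o F) g _ _ _ Ig.
- by move=> n; apply/measurable_EFinP; apply: measurable_sum => i; exact: mf.
- exact/measurable_EFinP.
- by apply: aeW => x Dx; apply: cvg_EFin; [exact: nearW|exact: fF].
- by apply: aeW => x n Dx; exact: series_le.
have -> : series (fun n => \int[mu]_(x in D) f n x) =
    fine \o (fun n => \int[mu]_(x in D) (series (f ^~ x) n)%:E)%E.
  apply/funext => n /=; rewrite /series/=.
  under [in RHS]eq_integral do rewrite -sumEFin.
  rewrite integral_sum//.
  rewrite (eq_bigr (fun i => (\int[mu]_(x in D) f i x)%:E)) ?sumEFin//.
  by move=> i _; rewrite fineK//; apply: integrable_fin_num => //; exact: If.
apply: fine_cvg; rewrite /Rintegral fineK//.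
by apply: integrable_fin_num => //; exact: integrable_series.
Qed.
End termwise.

(** * Mittag-Leffler functions and modes *)

Section mittag_leffler.
Context {R : realType}.
Local Notation mu := (@lebesgue_measure R).

Lemma cvg_seriesZ (u : R^nat) (c l : R) : series u @ \oo --> l ->
  series (fun n => c * u n) @ \oo --> c * l.
Proof.
move=> ul; have -> : series (fun n => c * u n) = fun n => c * series u n.
  by apply/funext => n; rewrite /series/= mulr_sumr.
by apply: cvgM => //; exact: cvg_cst.
Qed.

Lemma mittag_leffler_arg_gt0 (a b : R) n : 0 < a -> 0 < b -> 0 < a * n%:R + b.
Proof. by move=> a0 b0; rewrite ltr_wpDl// mulr_ge0// ltW. Qed.

Lemma normr_mittag_leffler_term (a b x : R) n : 0 < a -> 0 < b ->
  `|mittag_leffler_term a b x n| = mittag_leffler_term a b `|x| n.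
Proof.
move=> a0 b0; rewrite /mittag_leffler_term normrM normrX normfV.
by rewrite (gtr0_norm (Gamma_gt0 _))// mittag_leffler_arg_gt0.
Qed.

Lemma mittag_leffler_term_ge0 (a b x : R) n : 0 < a -> 0 < b -> 0 <= x ->
  0 <= mittag_leffler_term a b x n.
Proof.
move=> a0 b0 x0; rewrite -(ger0_norm x0) -normr_mittag_leffler_term//.
Qed.

Lemma cvg_series_mittag_leffler_normr (a b x : R) : 0 < a -> 0 < b ->
  cvgn (series (mittag_leffler_term a b `|x|)).
Proof.
(* With [A^a = B], [Gamma_lower] bounds the n-th term by a constant times [(|x| / B)^n], and
   [|x| / B <= 1/2]. The summand 1 keeps [B] positive at [x = 0]. *)
move=> a0 b0; pose B := 2 * `|x| + 1; pose A := B `^ a^-1.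
have B0 : 0 < B by rewrite ltr_wpDl// mulr_ge0.
have A0 : 0 < A by rewrite powR_gt0.
have A10 : 0 < A + 1 by rewrite addr_gt0.
pose C := ((A `^ b)^-1 * (A + 1) * expR (A + 1)).
have C0 : 0 <= C by rewrite !mulr_ge0 ?invr_ge0 ?powR_ge0 ?expR_ge0 ?ltW.
apply: (@series_le_cvg _ _ (geometric C 2^-1)).
- by move=> n; exact: mittag_leffler_term_ge0.
- by move=> n; rewrite /= mulr_ge0// exprn_ge0// invr_ge0.
- move=> n; have ab0 := mittag_leffler_arg_gt0 n a0 b0.
  have := Gamma_lower ab0 A0.
  have -> : A `^ (a * n%:R + b) = B ^+ n * A `^ b.
    rewrite powRD ?(gt_eqF A0) ?implybT//; congr (_ * _).
    by rewrite /A -powRrM mulrA mulVf ?gt_eqF// mul1r powR_mulrn// ltW.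
  move=> lo; rewrite /mittag_leffler_term /=.
  apply: (@le_trans _ _ (`|x| ^+ n / (B ^+ n * A `^ b / (A + 1) * expR (- (A + 1))))).
    rewrite ler_wpM2l ?exprn_ge0// lef_pV2// posrE ?Gamma_gt0//.
    by rewrite !(mulr_gt0, exprn_gt0, powR_gt0, expR_gt0, invr_gt0).
  have -> : `|x| ^+ n / (B ^+ n * A `^ b / (A + 1) * expR (- (A + 1))) =
      (`|x| / B) ^+ n * C.
    rewrite expRN expr_div_n /C; field.
    by rewrite !gt_eqF ?exprn_gt0 ?expR_gt0 ?powR_gt0.
  rewrite mulrC ler_wpM2l// lerXn2r// ?nnegrE ?divr_ge0 ?invr_ge0 ?(ltW B0)//.
  rewrite ler_pdivrMr// /B; have := normr_ge0 x; lra.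
apply: is_cvg_geometric_series; rewrite gtr0_norm ?invr_gt0//.
by rewrite invf_lt1// ltr1n.
Qed.

Let normed_seriesE (a b x : R) : 0 < a -> 0 < b ->
  [normed series (mittag_leffler_term a b x)] =
  series (mittag_leffler_term a b `|x|).
Proof.
by move=> *; congr series; apply/funext => n; exact: normr_mittag_leffler_term.
Qed.

Lemma cvg_series_mittag_leffler (a b x : R) : 0 < a -> 0 < b ->
  cvgn (series (mittag_leffler_term a b x)).
Proof.
move=> a0 b0; apply: normed_cvg; rewrite normed_seriesE//.
exact: cvg_series_mittag_leffler_normr.
Qed.

Lemma le_mittag_leffler_norm (a b x : R) : 0 < a -> 0 < b ->
  `|mittag_leffler a b x| <= mittag_leffler a b `|x|.
Proof.
move=> a0 b0; rewrite /mittag_leffler.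
rewrite -normed_seriesE//; apply: lim_series_norm; rewrite normed_seriesE//.
exact: cvg_series_mittag_leffler_normr.
Qed.

Lemma Gamma_mittag_leffler_le (a b0 b x : R) : 0 < a -> 0 < b0 -> b0 <= b ->
  0 <= x -> Gamma b * mittag_leffler a b x <= Gamma b0 * mittag_leffler a b0 x.
Proof.
move=> a0 b00 b0b x0; have b_gt0 : 0 < b by exact: lt_le_trans b0b.
have cv c : 0 < c -> cvgn (series (mittag_leffler_term a c x)).
  by move=> c0; exact: cvg_series_mittag_leffler.
have E c : 0 < c -> series (fun n => Gamma c * mittag_leffler_term a c x n) @ \oo
    --> Gamma c * mittag_leffler a c x.
  by move=> c0; apply: cvg_seriesZ; exact: cv.
apply: (ler_cvg_to (E _ b_gt0) (E _ b00)); apply: nearW => n.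
apply: ler_sum => i _; rewrite /mittag_leffler_term.
rewrite mulrCA [leRHS]mulrCA; apply: ler_wpM2l; first exact: exprn_ge0.
(* At index 0 both ratios are 1, whereas [Gamma_ratio_le] asks for a positive shift. *)
have [->|i0] := posnP i.
  by rewrite mulr0 !add0r !divff// gt_eqF// Gamma_gt0.
by apply: Gamma_ratio_le => //; rewrite mulr_gt0// ltr0n.
Qed.

Local Opaque mittag_leffler.

(* The solution of the kinetic equation with source [s `^ (b - 1)]. *)
Definition kinetic_mode (a lam b s : R) : R :=
  s `^ (b - 1) * (Gamma b * mittag_leffler a b (- (lam * s `^ a))).

(** The n-th Neumann term, [(- lam I)^n] applied to [s^(b - 1)]. *)
Definition kinetic_mode_term (a lam b s : R) (n : nat) : R :=
  (- lam) ^+ n * (Gamma b / Gamma (a * n%:R + b)) * s `^ (a * n%:R + b - 1).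

Lemma kinetic_mode_termE (a lam b s : R) n : 0 < s ->
  kinetic_mode_term a lam b s n =
  s `^ (b - 1) * (Gamma b * mittag_leffler_term a b (- (lam * s `^ a)) n).
Proof.
move=> s0; rewrite /kinetic_mode_term /mittag_leffler_term -mulNr exprMn.
have -> : s `^ (a * n%:R + b - 1) = (s `^ a) ^+ n * s `^ (b - 1).
  rewrite -addrA (@powRD _ s (a * n%:R)) ?(gt_eqF s0) ?implybT//.
  by rewrite (powRrM s a) powR_mulrn ?powR_ge0.
ring.
Qed.

Lemma cvg_kinetic_mode (a lam b s : R) : 0 < a -> 0 < b -> 0 < s ->
  series (kinetic_mode_term a lam b s) @ \oo --> kinetic_mode a lam b s.
Proof.
move=> a0 b0 s0.
have -> : kinetic_mode_term a lam b s = fun n => s `^ (b - 1) *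
    (Gamma b * mittag_leffler_term a b (- (lam * s `^ a)) n).
  by apply/funext => n; exact: kinetic_mode_termE.
by do 2 apply: cvg_seriesZ; exact: cvg_series_mittag_leffler.
Qed.

(** Absolute values undo the alternating sign, so the mode with parameter [- lam] is the
    majorant. *)
Lemma cvg_kinetic_mode_norm (a lam b s : R) : 0 < a -> 0 <= lam -> 0 < b -> 0 < s ->
  series (fun n => `|kinetic_mode_term a lam b s n|) @ \oo -->
  kinetic_mode a (- lam) b s.
Proof.
move=> a0 lam0 b0 s0.
rewrite (_ : (fun n => _) = kinetic_mode_term a (- lam) b s).
  exact: cvg_kinetic_mode.
apply/funext => n; rewrite /kinetic_mode_term opprK !normrM normrX normrN.
rewrite normfV (gtr0_norm (Gamma_gt0 b0)).
rewrite (gtr0_norm (Gamma_gt0 (mittag_leffler_arg_gt0 n a0 b0))).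
by rewrite (ger0_norm lam0) (ger0_norm (powR_ge0 _ _)).
Qed.

(** On the right [b] survives only in the power of [s], which makes the bound uniform over all
    modes. *)
Lemma kinetic_modeN_le (a lam b0 b s : R) : 0 < a -> 0 <= lam -> 0 < b0 ->
  b0 <= b -> kinetic_mode a (- lam) b s <=
  s `^ (b - 1) * (Gamma b0 * mittag_leffler a b0 (lam * s `^ a)).
Proof.
move=> a0 lam0 b00 b0b; rewrite /kinetic_mode mulNr opprK.
apply: ler_wpM2l; first exact: powR_ge0.
by apply: Gamma_mittag_leffler_le => //; rewrite mulr_ge0 ?powR_ge0.
Qed.

Lemma normr_kinetic_mode_le (a lam b s : R) : 0 < a -> 0 <= lam -> 0 < b ->
  `|kinetic_mode a lam b s| <= kinetic_mode a (- lam) b s.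
Proof.
move=> a0 lam0 b0; rewrite /kinetic_mode normrM (ger0_norm (powR_ge0 _ _)).
apply: ler_wpM2l; first exact: powR_ge0.
rewrite normrM (gtr0_norm (Gamma_gt0 b0)).
apply: ler_wpM2l; first exact: ltW (Gamma_gt0 b0).
apply: le_trans (le_mittag_leffler_norm _ a0 b0) _.
by rewrite normrN mulNr opprK ger0_norm// mulr_ge0 ?powR_ge0.
Qed.

Let RL_term (a lam b t : R) (n : nat) (s : R) :=
  (t - s) `^ (a - 1) * kinetic_mode_term a lam b s n.

Let measurable_RL_term (a lam b t : R) n (D : set R) :
  measurable_fun D (RL_term a lam b t n).
Proof.
apply: measurable_funM; first exact: measurable_RL_kernel.
by apply: measurable_funM => //; exact: measurable_funTS.
Qed.

(** Coefficient identity behind the passage from term [n] to term [n.+1], with positive variables in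
    place of the Gamma values so that [field] applies. *)
Let RL_coef (lam ga gb g0 g1 T : R) n : 0 < lam -> 0 < g0 -> 0 < g1 ->
  (- lam) ^+ n * (gb / g0) * (T * (ga * g0 / g1)) =
  - (ga / lam) * ((- lam) ^+ n.+1 * (gb / g1) * T).
Proof. by move=> *; rewrite exprS; field; rewrite !gt_eqF. Qed.

Let RL_coef_norm (lam ga gb g0 g1 T : R) n :
  0 < lam -> 0 < gb -> 0 < g0 -> 0 < g1 ->
  `|(- lam) ^+ n * (gb / g0)| * (T * (ga * g0 / g1)) =
  ga / lam * (`|(- lam) ^+ n.+1 * (gb / g1)| * T).
Proof.
move=> lam0 gb0 g00 g10; rewrite !normrM !normfV !normrX normrN !gtr0_norm// exprS.
by field; rewrite !gt_eqF.
Qed.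

Let integral_RL_term_norm (a lam b t : R) n : 0 < a -> 0 < lam -> 0 < b -> 0 < t ->
  (\int[mu]_(s in `]0%R, t[) `|RL_term a lam b t n s|%:E =
   (Gamma a / lam * `|kinetic_mode_term a lam b t n.+1|)%:E)%E.
Proof.
move=> a0 lam0 b0 t0; have ab0 := mittag_leffler_arg_gt0 n a0 b0.
have ab1 := mittag_leffler_arg_gt0 n.+1 a0 b0.
pose K := `|(- lam) ^+ n * (Gamma b / Gamma (a * n%:R + b))|.
transitivity (\int[mu]_(s in `]0%R, t[)
    (K%:E * ((t - s) `^ (a - 1) * s `^ (a * n%:R + b - 1))%:E))%E.
  apply: eq_integral => s _; rewrite -EFinM; congr EFin.
  rewrite /RL_term /kinetic_mode_term !normrM !(ger0_norm (powR_ge0 _ _)) /K.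
  by rewrite !normrM mulrCA.
rewrite ge0_integralZl//=.
- rewrite integral_RL_powR// -EFinM; congr EFin.
  rewrite /kinetic_mode_term normrM (ger0_norm (powR_ge0 _ _)) /K.
  have -> : a + (a * n%:R + b) = a * n.+1%:R + b by rewrite -addn1 natrD; ring.
  by apply: RL_coef_norm => //; exact: Gamma_gt0.
- by apply/measurable_EFinP; exact: measurable_RL_powR.
- by move=> s _; rewrite lee_fin mulr_ge0 ?powR_ge0.
- by rewrite lee_fin; exact: normr_ge0.
Qed.

(** After division by [Gamma a] this says that [- lam I] sends each Neumann term to the next. *)
Let Rintegral_RL_term (a lam b t : R) n : 0 < a -> 0 < lam -> 0 < b -> 0 < t ->
  \int[mu]_(s in `]0, t[) RL_term a lam b t n s =
   - (Gamma a / lam) * kinetic_mode_term a lam b t n.+1.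
Proof.
move=> a0 lam0 b0 t0; have ab0 := mittag_leffler_arg_gt0 n a0 b0.
have ab1 := mittag_leffler_arg_gt0 n.+1 a0 b0.
rewrite /Rintegral.
have I : mu.-integrable `]0, t[ (fun s =>
    ((t - s) `^ (a - 1) * s `^ (a * n%:R + b - 1))%:E).
  apply/integrableP; split.
    by apply/measurable_EFinP; exact: measurable_RL_powR.
  under eq_integral do rewrite gee0_abs ?lee_fin ?mulr_ge0 ?powR_ge0//.
  by rewrite integral_RL_powR// ltry.
under eq_integral => s _.
  rewrite (_ : RL_term _ _ _ _ _ _ =
    ((- lam) ^+ n * (Gamma b / Gamma (a * n%:R + b))) *
    ((t - s) `^ (a - 1) * s `^ (a * n%:R + b - 1)))%R; last first.
    by rewrite /RL_term /kinetic_mode_term mulrCA.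
  rewrite EFinM; over.
rewrite integralZl//= integral_RL_powR//=.
rewrite /kinetic_mode_term.
have -> : a + (a * n%:R + b) = a * n.+1%:R + b by rewrite -addn1 natrD; ring.
by apply: RL_coef => //; exact: Gamma_gt0.
Qed.

Lemma kinetic_mode_term0 (a lam b t : R) : 0 < b ->
  kinetic_mode_term a lam b t 0 = t `^ (b - 1).
Proof.
move=> b0; rewrite /kinetic_mode_term expr0 mul1r mulr0 add0r divff ?mul1r//.
by rewrite gt_eqF ?Gamma_gt0.
Qed.

Lemma cvg_seriesS (u : R^nat) (l : R) : series u @ \oo --> l ->
  series (fun n => u n.+1) @ \oo --> l - u 0.
Proof.
move=> ul; have -> : series (fun n => u n.+1) = fun n => series u n.+1 - u 0.
  by apply/funext => n; rewrite /series/= big_nat_recl// addrAC subrr add0r.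
by apply: cvgB; [rewrite cvg_shiftS|exact: cvg_cst].
Qed.

Section RL_mode.
Variables (a lam b t : R).
Hypotheses (a0 : 0 < a) (lam0 : 0 < lam) (b0 : 0 < b) (t0 : 0 < t).

Let F s := (t - s) `^ (a - 1) * kinetic_mode a lam b s.

Let fF s : `]0, t[%classic s -> series (RL_term a lam b t ^~ s) @ \oo --> F s.
Proof.
rewrite /= in_itv/= => /andP[s0 st].
by apply: cvg_seriesZ; exact: cvg_kinetic_mode.
Qed.

Let mD : measurable (`]0, t[%classic : set R).
Proof. exact: measurable_itv. Qed.

Let mf n : measurable_fun (`]0, t[%classic : set R) (RL_term a lam b t n).
Proof. exact: measurable_RL_term. Qed.

Let cvg_norm : series (fun n => Gamma a / lam * `|kinetic_mode_term a lam b t n.+1|)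
  @ \oo --> Gamma a / lam * (kinetic_mode a (- lam) b t - t `^ (b - 1)).
Proof.
have := cvg_kinetic_mode_norm a0 (ltW lam0) b0 t0 => /cvg_seriesS.
rewrite kinetic_mode_term0// (ger0_norm (powR_ge0 _ _)).
exact: cvg_seriesZ.
Qed.

Let intf n : (\int[mu]_(s in `]0%R, t[) `|RL_term a lam b t n s|%:E <=
   (Gamma a / lam * `|kinetic_mode_term a lam b t n.+1|)%:E)%E.
Proof. by rewrite integral_RL_term_norm. Qed.

Lemma integrable_RL_kinetic_mode : mu.-integrable `]0, t[ (EFin \o F).
Proof.
exact: (@integrable_series _ _ R mu _ mD _ _ _ mf fF intf (cvgP _ cvg_norm)).
Qed.

Lemma integral_RL_kinetic_mode_norm_le :
  (\int[mu]_(s in `]0%R, t[) `|F s|%:E <=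
   (Gamma a / lam * kinetic_mode a (- lam) b t)%:E)%E.
Proof.
have H := @integral_abs_series_le _ _ R mu _ mD _ _ _ mf fF intf (cvgP _ cvg_norm).
apply: le_trans H _; rewrite lee_fin (cvg_lim _ cvg_norm)//.
by rewrite ler_wpM2l ?divr_ge0 ?(ltW lam0) ?(ltW (Gamma_gt0 a0))// gerBl powR_ge0.
Qed.

(** Termwise integration shifts the Neumann series by one, so only its first term [t^(b - 1)] is
    lost; equivalently the mode solves the equation with that power as source. *)
Lemma Rintegral_RL_kinetic_mode :
  \int[mu]_(s in `]0, t[) F s =
  Gamma a / lam * (t `^ (b - 1) - kinetic_mode a lam b t).
Proof.
have := @cvg_series_Rintegral _ _ R mu _ mD _ _ _ mf fF intf (cvgP _ cvg_norm).
rewrite (_ : (fun n => Rintegral _ _ _) =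
    (fun n => - (Gamma a / lam) * kinetic_mode_term a lam b t n.+1)); last first.
  by apply/funext => n; exact: Rintegral_RL_term.
move=> H1; have := @cvg_kinetic_mode a lam b t a0 b0 t0 => /cvg_seriesS.
rewrite kinetic_mode_term0// => H2.
have := @cvg_seriesZ _ (- (Gamma a / lam)) _ H2.
by rewrite mulNr -mulrN opprB => /(cvg_unique _ H1); apply; exact: Rhausdorff.
Qed.
End RL_mode.
End mittag_leffler.

(** * Superposition of modes for a source that is a series of powers *)

Section kinetic_series.
Context {R : realType}.
Local Notation mu := (@lebesgue_measure R).
Variables (a lam b0 : R) (w b : nat -> R).
Hypotheses (a0 : 0 < a) (lam0 : 0 < lam) (b00 : 0 < b0).
Hypothesis b0b : forall r, b0 <= b r.
Hypothesis cw : forall t, 0 < t -> cvgn (series (fun r => `|w r| * t `^ (b r - 1))).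

Let b_gt0 r : 0 < b r. Proof. exact: lt_le_trans (b0b r). Qed.

Let M r t := kinetic_mode a lam (b r) t.
(** Common bound for the Mittag-Leffler factors of all modes, taken from the smallest exponent. *)
Let H t := Gamma b0 * mittag_leffler a b0 (lam * t `^ a).
Let N t := limn (series (fun r => w r * M r t)).

Let wM_le r t : `|w r| * kinetic_mode a (- lam) (b r) t <=
  H t * (`|w r| * t `^ (b r - 1)).
Proof.
rewrite [leRHS]mulrCA; apply: ler_wpM2l => //.
by rewrite [leRHS]mulrC; apply: kinetic_modeN_le => //; exact: ltW.
Qed.

Lemma cvg_kinetic_series t : 0 < t -> cvgn (series (fun r => w r * M r t)).
Proof.
move=> t0; apply: normed_cvg.
apply: (@series_le_cvg _ _ (fun r => H t * (`|w r| * t `^ (b r - 1)))) => //.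
- by move=> n /=; exact: normr_ge0.
- move=> r /=; apply: le_trans (wM_le r t).
  apply: mulr_ge0 => //.
  exact: le_trans (normr_ge0 _) (normr_kinetic_mode_le t a0 (ltW lam0) (b_gt0 r)).
- move=> r /=; apply: le_trans (wM_le r t).
  rewrite normrM; apply: ler_wpM2l => //.
  by apply: normr_kinetic_mode_le => //; exact: ltW.
- by apply: cvgP; apply: cvg_seriesZ; exact: cw t0.
Qed.

Section at_t.
Variables (t : R) (t0 : 0 < t).

Let f r s := w r * ((t - s) `^ (a - 1) * M r s).

Let F s := (t - s) `^ (a - 1) * N s.

Let mD : measurable (`]0, t[%classic : set R).
Proof. exact: measurable_itv. Qed.

Let intM r := integrable_RL_kinetic_mode a0 lam0 (b_gt0 r) t0.

Let mf r : measurable_fun (`]0, t[%classic : set R) (f r).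
Proof.
apply: measurable_funM => //.
by have /integrableP[/measurable_EFinP] := intM r.
Qed.

Let fF s : `]0, t[%classic s -> series (f ^~ s) @ \oo --> F s.
Proof.
rewrite /= in_itv/= => /andP[s0 st].
rewrite (_ : f ^~ s = fun r => (t - s) `^ (a - 1) * (w r * M r s)).
  by apply: cvg_seriesZ; exact: cvg_kinetic_series.
by apply/funext => r; rewrite /f mulrCA.
Qed.

(** Bounds the L1 norm of the r-th integrand; it is summable because [cw] holds at [t] itself. *)
Let m r := Gamma a / lam * (H t * (`|w r| * t `^ (b r - 1))).

Let intf r : (\int[mu]_(s in `]0%R, t[) `|f r s|%:E <= (m r)%:E)%E.
Proof.
under eq_integral do rewrite /f normrM EFinM.
rewrite ge0_integralZl//=; last first.
  apply/measurable_EFinP; apply: measurableT_comp => //.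
  by have /integrableP[/measurable_EFinP] := intM r.
apply: le_trans (lee_wpmul2l _
    (integral_RL_kinetic_mode_norm_le a0 lam0 (b_gt0 r) t0)) _.
  by rewrite lee_fin.
rewrite -EFinM lee_fin mulrCA /m; apply: ler_wpM2l; last exact: wM_le.
by rewrite divr_ge0// ltW// Gamma_gt0.
Qed.

Let cm : cvgn (series m).
Proof. by apply: cvgP; do 2 apply: cvg_seriesZ; exact: cw t0. Qed.

Lemma integrable_RL_kinetic_series : mu.-integrable `]0, t[ (EFin \o F).
Proof. exact: (@integrable_series _ _ R mu _ mD _ _ _ mf fF intf cm). Qed.

(** Each mode integrates to [Gamma a / lam] times power minus mode; summed over [r] this is source
    minus [N]. *)
Lemma kinetic_series_eq :
  N t - limn (series (fun r => w r * t `^ (b r - 1))) =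
  - lam * ((Gamma a)^-1 * \int[mu]_(s in `]0, t[) F s).
Proof.
have := @cvg_series_Rintegral _ _ R mu _ mD _ _ _ mf fF intf cm.
pose v r := w r * t `^ (b r - 1).
rewrite (_ : (fun n => Rintegral _ _ _) =
    (fun r => Gamma a / lam * (v r - w r * M r t))); last first.
  apply/funext => r; rewrite /f RintegralZl//; last exact: intM.
  by rewrite Rintegral_RL_kinetic_mode// /v /M; ring.
have cv : cvgn (series v).
  apply: normed_cvg; apply: (@series_le_cvg _ _ (fun r => `|w r| * t `^ (b r - 1))).
  - by move=> n /=; exact: normr_ge0.
  - by move=> n; rewrite mulr_ge0 ?powR_ge0.
  - by move=> n; rewrite /= normrM (ger0_norm (powR_ge0 _ _)).
  - exact: cw.
have cvM : series (fun r => v r - w r * M r t) @ \oo --> limn (series v) - N t.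
  rewrite (_ : series _ = series v \- series (fun r => w r * M r t)).
    by apply: cvgB => //; exact: cvg_kinetic_series.
  by apply/funext => n; rewrite /series/= sumrB.
have := @cvg_seriesZ _ _ (Gamma a / lam) _ cvM => H1 /(cvg_unique _ H1) <-//.
rewrite -/v; have := Gamma_gt0 a0; move: (Gamma a) (limn _) (N t) => g x y g0.
by field; rewrite !gt_eqF.
Qed.
End at_t.
End kinetic_series.

(** * The homogeneous equation *)

Section uniqueness.
Context {R : realType}.
Local Notation mu := (@lebesgue_measure R).

(** The power is monotone, in a direction given by the sign of [p]; the sum of the endpoint values
    covers both. *)
Lemma powR_le_itv (A B x p : R) : 0 < A -> A <= x <= B ->
  x `^ p <= A `^ p + B `^ p.
Proof.
move=> A0 /andP[Ax xB].
have x0 : 0 < x by exact: lt_le_trans Ax.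
have B0 : 0 < B by exact: lt_le_trans xB.
have [p0|p0] := leP 0 p.
  apply: (@le_trans _ _ (B `^ p)); last by rewrite lerDr powR_ge0.
  by apply: ge0_ler_powR => //; rewrite nnegrE ltW.
apply: (@le_trans _ _ (A `^ p)); last by rewrite lerDl powR_ge0.
rewrite -(opprK p) powRN [leRHS]powRN lef_pV2 ?posrE ?powR_gt0//.
by apply: ge0_ler_powR => //; rewrite ?nnegrE ?oppr_ge0 ltW.
Qed.

Variables (a c : R) (u : R -> R).
Hypothesis a0 : 0 < a.
Hypothesis uI : forall t, 0 < t ->
  mu.-integrable `]0, t[ (fun s => ((t - s) `^ (a - 1) * u s)%:E).

(** Apply [uI] at [2 * T]: on []0, T[] the base [2 * T - s] stays between [T] and [2 * T], so the
    kernel can be divided out by a bounded factor. *)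
Let integrable_u (T : R) : 0 < T -> mu.-integrable `]0, T[ (EFin \o u).
Proof.
move=> T0; have T20 : 0 < 2 * T by rewrite mulr_gt0.
pose h s := (2 * T - s) `^ (1 - a).
have mD : measurable (`]0, T[%classic : set R) by exact: measurable_itv.
have TT : T < 2 * T by lra.
have sT : mu.-integrable `]0, T[ (fun s => ((2 * T - s) `^ (a - 1) * u s)%:E).
  apply: integrableS (uI T20) => //.
  move=> x /=; rewrite !in_itv/= => /andP[-> xT]; exact: lt_trans TT.
have mh : measurable_fun (`]0, T[%classic : set R) h.
  apply: measurable_powR_comp => //; apply: measurable_funTS.
  exact: measurable_funB.
have bh : [bounded h x | x in (`]0, T[%classic : set R)].
  exists (T `^ (1 - a) + (2 * T) `^ (1 - a)); split; first exact: num_real.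
  move=> y Ty s; rewrite /= in_itv/= => /andP[s0 sT'].
  rewrite (ger0_norm (powR_ge0 _ _)); apply: le_trans (ltW Ty).
  by apply: powR_le_itv => //; apply/andP; split; lra.
have HI := @integrableMr _ _ _ mu _ mD _ _ mh bh sT.
apply: (@eq_integrable _ _ _ mu _ mD _ _ _ HI).
move=> s; rewrite inE/= in_itv/= => /andP[s0 sT'] /=.
rewrite -EFinM mulrA -powRD.
  by rewrite (_ : 1 - a + (a - 1) = 0) ?powRr0 ?mul1r//; ring.
by apply/implyP => _; rewrite gt_eqF//; lra.
Qed.

Hypothesis ue : forall t, 0 < t ->
  u t = c * \int[mu]_(s in `]0, t[) ((t - s) `^ (a - 1) * u s).

Section weight.
Variables (T k : R) (T0 : 0 < T) (k0 : 0 < k).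

Let g : R -> R := (fun s => expR (- (k * s)) * `|u s|) \_ `]0, T[.

Let g_ge0 s : 0 <= g s.
Proof. by apply: restrict_ge0 => x _; rewrite mulr_ge0 ?expR_ge0. Qed.

Let measurable_g_itv :
  measurable_fun (`]0, T[%classic : set R) (fun s => expR (- (k * s)) * `|u s|).
Proof.
apply: measurable_funM.
  apply: measurable_funTS; apply: measurableT_comp => //.
  by apply: measurableT_comp => //; exact: measurable_funM.
apply: measurableT_comp => //.
by have /integrableP[/measurable_EFinP] := integrable_u T0.
Qed.

Let measurable_g : measurable_fun setT g.
Proof. by apply/(measurable_restrictT _ _).1 => //; exact: measurable_itv. Qed.

Let gE s : 0 < s -> s < T -> g s = expR (- (k * s)) * `|u s|.
Proof. by move=> s0 sT; rewrite /g patchE mem_set//= in_itv/= s0. Qed.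

Let integral_g_lty : (\int[mu]_s (g s)%:E < +oo)%E.
Proof.
have /integrableP[mu' lu] := integrable_u T0.
rewrite /g integral_patch; apply: le_lt_trans lu.
apply: ge0_le_integral => //=.
- by apply/measurable_EFinP; exact: measurable_g_itv.
- apply/measurable_EFinP; apply: measurableT_comp => //; exact/measurable_EFinP.
- move=> s; rewrite in_itv/= => /andP[s0 sT]; rewrite lee_fin.
  by rewrite ler_piMl// expR_le1 oppr_le0 mulr_ge0// ltW.
Qed.

(** Take absolute values in [ue] and split [exp (- k t)] as [exp (- k (t - s)) * exp (- k s)]: the
    first factor completes the Gamma kernel, the second the weight in [g]. *)
Let g_le_convolution t :
  ((g t)%:E <= `|c|%:E * \int[mu]_s ((gamma_kernel a k (t - s))%:E * (g s)%:E))%E.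
Proof.
have R0 : (0 <= \int[mu]_s ((gamma_kernel a k (t - s))%:E * (g s)%:E))%E.
  by apply: integral_ge0 => s _; rewrite -EFinM lee_fin mulr_ge0 ?gamma_kernel_ge0.
rewrite {1}/g patchE; case: ifPn => [|_]; last first.
  by rewrite mule_ge0 ?lee_fin.
rewrite inE/= in_itv/= => /andP[t0 tT].
have mD : measurable (`]0, t[%classic : set R) by exact: measurable_itv.
apply: (@le_trans _ _ (`|c|%:E * ((expR (- (k * t)))%:E *
    \int[mu]_(s in `]0%R, t[) `|(t - s) `^ (a - 1) * u s|%:E))%E).
  rewrite (ue t0) normrM mulrCA EFinM; apply: lee_wpmul2l; first by rewrite lee_fin.
  rewrite EFinM; apply: lee_wpmul2l; first by rewrite lee_fin expR_ge0.
  rewrite EFin_normr_Rintegral//; last exact: uI.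
  apply: le_abse_integral => //.
  by have /integrableP[] := uI t0.
apply: lee_wpmul2l; first by rewrite lee_fin.
have mRL : measurable_fun (`]0, t[%classic : set R)
    (fun s => `|(t - s) `^ (a - 1) * u s|%:E).
  apply/measurable_EFinP; apply: measurableT_comp => //.
  by have /integrableP[/measurable_EFinP] := uI t0.
rewrite -ge0_integralZl//=.
have mgk : measurable_fun setT (fun s : R => (gamma_kernel a k (t - s))%:E).
  apply/measurable_EFinP; apply: (measurableT_comp (measurable_gamma_kernel a k)).
  exact: measurable_funB.
rewrite integral_mkcond; apply: ge0_le_integral => //=.
- by move=> s _; apply: erestrict_ge0 => x _; rewrite -EFinM lee_fin mulr_ge0 ?expR_ge0.
- by apply/(measurable_restrictT _ _).1 => //; exact: measurable_funeM.
- apply: emeasurable_funM; first exact: mgk.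
  exact/measurable_EFinP.
- move=> s _; rewrite patchE; case: ifPn => [|_]; last first.
    by rewrite -EFinM lee_fin mulr_ge0 ?gamma_kernel_ge0.
  rewrite inE/= in_itv/= => /andP[s0 st].
  rewrite gamma_kernelE ?subr_gt0// gE//; last exact: lt_trans tT.
  rewrite -!EFinM lee_fin normrM (ger0_norm (powR_ge0 _ _)).
  have -> : expR (- (k * t)) = expR (- (k * (t - s))) * expR (- (k * s)).
    by rewrite -expRD; congr expR; ring.
  by rewrite le_eqVlt; apply/orP; left; apply/eqP; ring.
Qed.

Let integral_g_le :
  (\int[mu]_s (g s)%:E <= (`|c| * (Gamma a / k `^ a))%:E * \int[mu]_s (g s)%:E)%E.
Proof.
have mk : measurable_fun setT (EFin \o gamma_kernel a k).
  by apply/measurable_EFinP; exact: measurable_gamma_kernel.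
have mg : measurable_fun setT (EFin \o g) by exact/measurable_EFinP.
have k_ge0 x : (0 <= (EFin \o gamma_kernel a k) x)%E.
  by rewrite lee_fin gamma_kernel_ge0.
have gg0 x : (0 <= (EFin \o g) x)%E by rewrite lee_fin.
rewrite EFinM -muleA -integral_gamma_kernel//.
rewrite -(ge0_integral_convolution mk k_ge0 mg gg0).
have mc : measurable_fun setT (fun t : R =>
    \int[mu]_s ((gamma_kernel a k (t - s))%:E * (g s)%:E))%E.
  apply: (@measurable_fun_fubini_tonelli_F _ _ _ _ _ mu
    (fun z : R * R => (gamma_kernel a k (z.1 - z.2))%:E * (g z.2)%:E)%E).
  - apply: emeasurable_funM.
      apply: (measurableT_comp mk); apply: measurable_funB.
        exact: measurable_fst.
      exact: measurable_snd.
    by apply: (measurableT_comp mg); exact: measurable_snd.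
  - by move=> x; rewrite -EFinM lee_fin mulr_ge0 ?gamma_kernel_ge0.
have c_ge0 t : (0 <= \int[mu]_s ((gamma_kernel a k (t - s))%:E * (g s)%:E))%E.
  by apply: integral_ge0 => s _; rewrite -EFinM lee_fin mulr_ge0 ?gamma_kernel_ge0.
rewrite -ge0_integralZl//=.
apply: ge0_le_integral => //=.
- by move=> x _; rewrite lee_fin.
- exact: measurable_funeM.
Qed.

Lemma weighted_integral_eq0 : `|c| * (Gamma a / k `^ a) < 1 ->
  ae_eq mu (`]0, T[%classic : set R) (EFin \o u) (cst 0%E).
Proof.
move=> q1.
have g0 : (\int[mu]_s `|(g s)%:E| = 0)%E.
  under eq_integral do rewrite gee0_abs ?lee_fin//.
  move: integral_g_le integral_g_lty.
  have : (0 <= \int[mu]_s (g s)%:E)%E by apply: integral_ge0 => s _; rewrite lee_fin.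
  (* The mass is finite and at most [q] times itself with [q < 1], hence zero. *)
  case: (integral _ _ _) => // x; rewrite -EFinM !lee_fin => x0 xq _.
  congr EFin; apply/eqP; rewrite eq_le x0 andbT leNgt; apply/negP => x_gt0.
  by move: xq; rewrite leNgt gtr_pMl// q1.
have mg : measurable_fun setT (EFin \o g) by exact/measurable_EFinP.
have H := (ae_eq_integral_abs mu measurableT mg).1 g0.
apply: filterS H => s gs0; rewrite /= in_itv/= => /andP[s0 sT].
have : g s = 0 by move: (gs0 Logic.I) => /= -[].
rewrite gE// => /eqP.
by rewrite mulf_eq0 gt_eqF ?expR_gt0//= normr_eq0 => /eqP ->.
Qed.
End weight.

Lemma RL_fixpoint_eq0 t : 0 < t -> u t = 0.
Proof.
move=> t0; rewrite ue//.
pose B := `|c| * Gamma a + 1.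
have B0 : 0 < B by rewrite ltr_wpDl// mulr_ge0// ltW// Gamma_gt0.
(* Chosen so that [k^a = |c| * Gamma a + 1], which makes the contraction factor less than 1. *)
pose k := B `^ a^-1.
have k0 : 0 < k by rewrite powR_gt0.
have ka : k `^ a = B by rewrite /k -powRrM mulVf ?gt_eqF// powRr1// ltW.
have := @weighted_integral_eq0 t k t0 k0.
rewrite ka mulrA ltr_pdivrMr// mul1r ltrDl ltr01 => /(_ isT) u0.
(* Vanishing almost everywhere suffices, since [u t] has been rewritten as an integral of [u]. *)
rewrite /Rintegral (@ae_eq_integral _ _ _ mu _ (cst 0)%E)//=.
- by rewrite integral0 mulr0.
- by have /integrableP[] := uI t0.
- by apply: filterS u0 => s us0 st; have /= -[->] := us0 st; rewrite mulr0.
Qed.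
End uniqueness.

(** * Complex series *)

Section complex_series.
Context {R : realType}.
Implicit Types (z : R[i]) (x y : R).

Lemma Re_mulC z x : complex.Re (z * x%:C) = complex.Re z * x.
Proof. by case: z => p q /=; rewrite mulr0 subr0. Qed.

Lemma Im_mulC z x : complex.Im (z * x%:C) = complex.Im z * x.
Proof. by case: z => p q /=; rewrite mulr0 add0r. Qed.

Lemma Re_Cmul x z : complex.Re (x%:C * z) = x * complex.Re z.
Proof. by rewrite mulrC Re_mulC mulrC. Qed.

Lemma Im_Cmul x z : complex.Im (x%:C * z) = x * complex.Im z.
Proof. by rewrite mulrC Im_mulC mulrC. Qed.

Lemma Re_addE z z' : complex.Re (z + z') = complex.Re z + complex.Re z'.
Proof. by case: z z' => [? ?] [? ?]. Qed.

Lemma Im_addE z z' : complex.Im (z + z') = complex.Im z + complex.Im z'.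
Proof. by case: z z' => [? ?] [? ?]. Qed.

Lemma Re_mulE z z' : complex.Re (z * z') =
  complex.Re z * complex.Re z' - complex.Im z * complex.Im z'.
Proof. by case: z z' => [? ?] [? ?]. Qed.

Lemma Im_mulE z z' : complex.Im (z * z') =
  complex.Re z * complex.Im z' + complex.Im z * complex.Re z'.
Proof. by case: z z' => [? ?] [? ?]. Qed.

Lemma normc_le z : `|z| <= (`|complex.Re z| + `|complex.Im z|)%:C.
Proof.
have p0 : 0 <= `|complex.Re z| + `|complex.Im z| by rewrite addr_ge0.
rewrite normc_def lecR -[leRHS](ger0_norm p0) -sqrtr_sqr; apply: ler_wsqrtr.
by rewrite sqrrD !real_normK ?num_real// addrAC lerDl mulrn_wge0 ?mulr_ge0.
Qed.

Lemma cvg_complex (u : nat -> R[i]) x y :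
  (fun n => complex.Re (u n)) @ \oo --> x ->
  (fun n => complex.Im (u n)) @ \oo --> y -> u @ \oo --> (x +i* y : R[i]).
Proof.
move=> /cvgrPdist_lt ux /cvgrPdist_lt uy; apply/cvgrPdist_lt => e e0.
(* The radius is an element of [R[i]]; being positive, it is real. *)
have eE : e = (complex.Re e)%:C by rewrite RRe_real// gtr0_real.
have e0' : 0 < complex.Re e / 2 by rewrite divr_gt0// -ltcR -eE.
apply: filterS2 (ux _ e0') (uy _ e0') => n.
move: (u n) => [p q] /= xp yq; apply: le_lt_trans (normc_le _) _ => /=.
by rewrite eE ltcR; lra.
Qed.

Lemma cvg_series_complex (u : nat -> R[i]) x y :
  series (fun n => complex.Re (u n)) @ \oo --> x ->
  series (fun n => complex.Im (u n)) @ \oo --> y ->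
  series u @ \oo --> (x +i* y : R[i]).
Proof.
move=> ux uy; apply: cvg_complex.
  rewrite (_ : (fun n => _) = series (fun n => complex.Re (u n)))//.
  apply/funext => n; rewrite /series/=; apply: (big_morph (@complex.Re R)) => //.
  exact: Re_addE.
rewrite (_ : (fun n => _) = series (fun n => complex.Im (u n)))//.
apply/funext => n; rewrite /series/=; apply: (big_morph (@complex.Im R)) => //.
exact: Im_addE.
Qed.

Lemma limn_series_complex (u : nat -> R[i]) :
  cvgn (series (fun n => complex.Re (u n))) ->
  cvgn (series (fun n => complex.Im (u n))) ->
  cvgn (series u) /\
  limn (series u) = limn (series (fun n => complex.Re (u n))) +i*
                    limn (series (fun n => complex.Im (u n))).
Proof.
move=> cr ci; have H := cvg_series_complex cr ci.
by split; [exact: cvgP H|apply: cvg_lim H => //; exact: norm_hausdorff].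
Qed.

Lemma normci : `|'i : R[i]| = 1.
Proof. by rewrite normc_def /= expr0n expr1n add0r sqrtr1. Qed.

Lemma ReNorm_exp z r : (complex.Re `|z| ^+ r)%:C = `|z ^+ r|.
Proof. by rewrite rmorphXn normrX. Qed.

Lemma normr_Re_exp_le z r : `|complex.Re (z ^+ r)| <= complex.Re `|z| ^+ r.
Proof. by rewrite -lecR ReNorm_exp; exact: normc_ge_Re. Qed.

Lemma normr_Im_exp_le z r : `|complex.Im (z ^+ r)| <= complex.Re `|z| ^+ r.
Proof.
(* Multiplication by [- 'i] preserves the modulus and moves the imaginary part to the real part. *)
rewrite -lecR ReNorm_exp (_ : complex.Im _ = complex.Re (- ('i * z ^+ r))).
  by apply: le_trans (normc_ge_Re _) _; rewrite normrN normrM normci mul1r.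
by case: (z ^+ r) => p q /=; rewrite mul0r mul1r sub0r opprK.
Qed.
End complex_series.

(** * The kinetic equation *)

Section RL_solution.
Context {R : realType}.
Local Notation mu := (@lebesgue_measure R).
Variables (a lam : R).

(** The real equation with an arbitrary source [g]. Kernel and [lam] are real, so the complex
    equation splits into two of these. *)
Definition RL_solution (g h : R -> R) := forall t : R, 0 < t ->
  mu.-integrable `]0, t[ (fun s => ((t - s) `^ (a - 1) * h s)%:E) /\
  h t - g t =
    - lam * ((Gamma a)^-1 * \int[mu]_(s in `]0, t[) ((t - s) `^ (a - 1) * h s)).

Lemma RL_solution_lin (p q : R) (g1 g2 h1 h2 : R -> R) :
  RL_solution g1 h1 -> RL_solution g2 h2 ->
  RL_solution (fun t => p * g1 t + q * g2 t) (fun t => p * h1 t + q * h2 t).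
Proof.
move=> S1 S2 t t0; have [I1 E1] := S1 t t0; have [I2 E2] := S2 t t0.
have mD : measurable (`]0, t[%classic : set R) by exact: measurable_itv.
pose f1 s := (t - s) `^ (a - 1) * h1 s; pose f2 s := (t - s) `^ (a - 1) * h2 s.
have J1 := @integrableZl _ _ _ mu _ mD p _ I1.
have J2 := @integrableZl _ _ _ mu _ mD q _ I2.
have FE s : (t - s) `^ (a - 1) * (p * h1 s + q * h2 s) = p * f1 s + q * f2 s.
  by rewrite /f1 /f2; ring.
split.
  apply: (@eq_integrable _ _ _ mu _ mD _ _ _ (@integrableD _ _ _ mu _ mD _ _ J1 J2)).
  by move=> s _; rewrite FE.
under eq_Rintegral do rewrite FE.
rewrite RintegralD// !RintegralZl//.
move: (\int[mu]_(s in _) f1 s) (\int[mu]_(s in _) f2 s) E1 E2 => x y.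
move=> /eqP; rewrite subr_eq => /eqP -> /eqP; rewrite subr_eq => /eqP ->.
ring.
Qed.

Lemma eq_RL_solution (g g' h h' : R -> R) :
  (forall t, 0 < t -> g t = g' t) -> (forall t, 0 < t -> h t = h' t) ->
  RL_solution g h -> RL_solution g' h'.
Proof.
move=> gg' hh' S t t0; have [I E] := S t t0.
have H s : s \in (`]0, t[%classic : set R) ->
    (t - s) `^ (a - 1) * h s = (t - s) `^ (a - 1) * h' s.
  by rewrite inE/= in_itv/= => /andP[s0 _]; rewrite hh'.
have mD : measurable (`]0, t[%classic : set R) by exact: measurable_itv.
split.
  by apply: (@eq_integrable _ _ _ mu _ mD _ _ _ I) => s sD; congr EFin; exact: H.
by rewrite -gg'// -hh'// E; congr (_ * (_ * _)); exact: eq_Rintegral.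
Qed.

(** By linearity the difference has source [g - g = 0] and is a fixed point as in
    [RL_fixpoint_eq0]. *)
Lemma RL_solution_unique (g h1 h2 : R -> R) : 0 < a ->
  RL_solution g h1 -> RL_solution g h2 -> forall t, 0 < t -> h1 t = h2 t.
Proof.
move=> a0 S1 S2 t t0; have S := RL_solution_lin 1 (- 1) S1 S2.
apply/eqP; rewrite -subr_eq0; apply/eqP.
transitivity (1 * h1 t + - 1 * h2 t); first by ring.
apply: (@RL_fixpoint_eq0 _ a (- lam / Gamma a) (fun t => 1 * h1 t + - 1 * h2 t)) => //.
- by move=> s /S[].
- by move=> s /S[_ E]; rewrite -mulrA -E; ring.
Qed.
End RL_solution.

(** * The k-Struve source and the explicit complex solution *)

Section kinetic.
Context {R : realType}.
Local Notation mu := (@lebesgue_measure R).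

Lemma kinetic_solutionP (k d upsilon l : R) (c N0 : R[i]) (N : R -> R[i]) :
  kinetic_solution k d upsilon l c N0 N <->
  RL_solution upsilon (d `^ upsilon)
    (fun t => complex.Re (N0 * kstruve k l c t)) (fun t => complex.Re (N t)) /\
  RL_solution upsilon (d `^ upsilon)
    (fun t => complex.Im (N0 * kstruve k l c t)) (fun t => complex.Im (N t)).
Proof.
have ReI t s : complex.Re (RL_integrand upsilon N t s) =
    (t - s) `^ (upsilon - 1) * complex.Re (N s).
  exact: Re_Cmul.
have ImI t s : complex.Im (RL_integrand upsilon N t s) =
    (t - s) `^ (upsilon - 1) * complex.Im (N s).
  exact: Im_Cmul.
have RE t : complex.Re (- (d `^ upsilon)%:C * RL_integral upsilon N t) =
    - (d `^ upsilon) * ((Gamma upsilon)^-1 *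
    \int[mu]_(s in `]0, t[) ((t - s) `^ (upsilon - 1) * complex.Re (N s))).
  rewrite -rmorphN !Re_Cmul /=; congr (_ * (_ * _)).
  by apply: eq_Rintegral => s _; exact: ReI.
have IE t : complex.Im (- (d `^ upsilon)%:C * RL_integral upsilon N t) =
    - (d `^ upsilon) * ((Gamma upsilon)^-1 *
    \int[mu]_(s in `]0, t[) ((t - s) `^ (upsilon - 1) * complex.Im (N s))).
  rewrite -rmorphN !Im_Cmul /=; congr (_ * (_ * _)).
  by apply: eq_Rintegral => s _; exact: ImI.
have FR t : (fun s => (complex.Re (RL_integrand upsilon N t s))%:E) =
    (fun s => ((t - s) `^ (upsilon - 1) * complex.Re (N s))%:E).
  by apply/funext => s; rewrite ReI.
have FI t : (fun s => (complex.Im (RL_integrand upsilon N t s))%:E) =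
    (fun s => ((t - s) `^ (upsilon - 1) * complex.Im (N s))%:E).
  by apply/funext => s; rewrite ImI.
split.
  move=> S; split=> t t0; have [[Ir Ii] E] := S t t0.
    split; first by rewrite -FR.
    by rewrite -RE -E; case: (N t) (N0 * _) => [? ?] [? ?].
  split; first by rewrite -FI.
  by rewrite -IE -E; case: (N t) (N0 * _) => [? ?] [? ?].
move=> [Sr Si] t t0; have [Ir Er] := Sr t t0; have [Ii Ei] := Si t t0.
split; first by split; rewrite ?FR ?FI.
move: Er Ei; rewrite -RE -IE.
case: (N t) (N0 * _) (_ * RL_integral _ _ _) => [? ?] [? ?] [? ?] /= <- <-.
by [].
Qed.

Variables (k d upsilon l : R) (c : R[i]).
Hypotheses (k_gt0 : 0 < k) (d_gt0 : 0 < d) (upsilon_gt0 : 0 < upsilon).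
Hypothesis l_gt : - (3 / 2 * k) < l.

(** [b r - 1] is the exponent of [t] in the r-th k-Struve term; the bound on [l] makes the smallest
    value [b0] exceed 1/2. *)
Let b r : R := 2 * r%:R + l / k + 2.
Let b0 : R := l / k + 2.
Let lam := d `^ upsilon.

Let lk : - (3 / 2) < l / k.
Proof. by rewrite ltr_pdivlMr// mulNr. Qed.

Let b0_gt0 : 0 < b0. Proof. rewrite /b0; move: lk; lra. Qed.

Let b0_le r : b0 <= b r.
Proof. by rewrite /b0 /b lerD2r lerDr mulr_ge0. Qed.

Let lam_gt0 : 0 < lam. Proof. exact: powR_gt0. Qed.

Let coef r : R := (kGamma k (r%:R * k + l + 3 / 2 * k) * Gamma (r%:R + 3 / 2))^-1
  * 2^-1 `^ (b r - 1).

Let powR_half t r : 0 < t ->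
  (t / 2) `^ (2 * r%:R + l / k + 1) = 2^-1 `^ (b r - 1) * t `^ (b r - 1).
Proof.
move=> t0; rewrite mulrC powRM ?(ltW t0) ?invr_ge0//.
by rewrite (_ : 2 * r%:R + l / k + 1 = b r - 1)// /b; ring.
Qed.

Let source_coef (z : R[i]) (x y s : R) :
  z / x%:C * (y * s)%:C = z * (x^-1 * y * s)%:C.
Proof. by rewrite -fmorphV -mulrA -rmorphM mulrA. Qed.

Let solution_coef (z : R[i]) (g x y s m : R) :
  z * g%:C / x%:C * (y * s)%:C * m%:C = z * (x^-1 * y * (s * (g * m)))%:C.
Proof.
by rewrite -fmorphV -!mulrA -!rmorphM; congr (_ * _%:C); ring.
Qed.

Let kstruve_termE t r : 0 < t ->
  kstruve_term k l c t r = (- c) ^+ r * (coef r * t `^ (b r - 1))%:C.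
Proof.
move=> t0; rewrite /kstruve_term (powR_half r t0) source_coef /coef.
by have -> : 3 * k / 2 = 3 / 2 * k by ring.
Qed.

Let solution_termE t r : 0 < t -> solution_term k d upsilon l c t r =
  (- c) ^+ r * (coef r * kinetic_mode upsilon lam (b r) t)%:C.
Proof.
by move=> t0; rewrite /solution_term (powR_half r t0) solution_coef.
Qed.

Let term_bound (p n kg K G h s T U : R) r : 0 <= n -> 0 < K -> 0 <= T ->
  `|kg| <= K -> `|p| <= n ^+ r -> h * s = T ^+ r * U -> 0 <= U -> 0 <= G ->
  0 <= s -> 0 <= h ->
  `|p * (kg * G * h)| * s <= K * U * ((n * T) ^+ r * G).
Proof.
move=> n0 K0 T0 kgK pn hs U0 G0 s0 h0.
rewrite !normrM (ger0_norm G0) (ger0_norm h0) exprMn -!mulrA hs.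
rewrite [leRHS](_ : _ = n ^+ r * (K * (G * (T ^+ r * U)))); last by ring.
have GTU : 0 <= G * (T ^+ r * U) by rewrite !mulr_ge0 ?exprn_ge0.
apply: ler_pM => //; first by rewrite mulr_ge0.
exact: ler_wpM2r.
Qed.

(** With [1 / kGamma] bounded by a constant, what remains is a multiple of the series of
    [E_(1, 3/2)] at [x = |c| * (t / 2)^2]. *)
Let coef_cvg (p : R^nat) : (forall r, `|p r| <= complex.Re `|c| ^+ r) ->
  forall t, 0 < t -> cvgn (series (fun r => `|p r * coef r| * t `^ (b r - 1))).
Proof.
move=> pc t t0; have [K K0 HK] := kGammaV_bounded k_gt0.
pose n := complex.Re `|c|.
pose x := n * (t / 2) ^+ 2.
have n0 : 0 <= n by rewrite -ler0c RRe_real ?normr_real.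
have x0 : 0 <= x by rewrite mulr_ge0// exprn_ge0// divr_ge0// ltW.
have h0 : 0 < (3 / 2 : R) by lra.
apply: (@series_le_cvg _ _ (fun r => K * (t / 2) `^ (l / k + 1) *
    mittag_leffler_term 1 (3 / 2) x r)).
- by move=> r; rewrite mulr_ge0 ?powR_ge0.
- move=> r; apply: mulr_ge0; first by rewrite mulr_ge0 ?powR_ge0 ?(ltW K0).
  exact: mittag_leffler_term_ge0.
- move=> r; have G0 : 0 < Gamma (r%:R + 3 / 2 : R).
    by apply: Gamma_gt0; rewrite ltr_wpDl.
  have kr : 0 < r%:R * k + l + 3 / 2 * k.
    rewrite -addrA ltr_wpDl ?mulr_ge0 ?(ltW k_gt0)//.
    by move: l_gt; lra.
  have t20 : 0 < t / 2 by rewrite divr_gt0.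
  have HTU : 2^-1 `^ (b r - 1) * t `^ (b r - 1) =
      ((t / 2) ^+ 2) ^+ r * (t / 2) `^ (l / k + 1).
    rewrite -(powR_half r t0) -addrA (@powRD _ _ (2 * r%:R)) ?(gt_eqF t20) ?implybT//.
    by rewrite -exprM -natrM powR_mulrn ?(ltW t20).
  have G0' : 0 <= (Gamma (r%:R + 3 / 2 : R))^-1 by rewrite invr_ge0 ltW.
  rewrite /mittag_leffler_term mul1r /coef invfM.
  apply: term_bound (HK _ kr) (pc r) HTU _ G0' _ _ => //; try exact: powR_ge0.
  by rewrite exprn_ge0 ?(ltW t20).
apply: cvgP; apply: cvg_seriesZ.
exact: cvg_series_mittag_leffler.
Qed.

Let pr r := complex.Re ((- c) ^+ r).
Let pi r := complex.Im ((- c) ^+ r).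

Let pr_le r : `|pr r| <= complex.Re `|c| ^+ r.
Proof. by rewrite -(normrN c); exact: normr_Re_exp_le. Qed.

Let pi_le r : `|pi r| <= complex.Re `|c| ^+ r.
Proof. by rewrite -(normrN c); exact: normr_Im_exp_le. Qed.

(** Only [(- c)^r] is complex in each term, so a generic [p] serves both the real and the imaginary
    series. *)
Let source (p : R^nat) t := limn (series (fun r => p r * coef r * t `^ (b r - 1))).
Let solution (p : R^nat) t :=
  limn (series (fun r => p r * coef r * kinetic_mode upsilon lam (b r) t)).

Let solutionP (p : R^nat) : (forall r, `|p r| <= complex.Re `|c| ^+ r) ->
  RL_solution upsilon lam (source p) (solution p).
Proof.
move=> pc t t0; split.
  exact: (integrable_RL_kinetic_series upsilon_gt0 lam_gt0 b0_gt0 b0_le (coef_cvg pc)).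
exact: (kinetic_series_eq upsilon_gt0 lam_gt0 b0_gt0 b0_le (coef_cvg pc)).
Qed.

Let cvg_solution (p : R^nat) t : (forall r, `|p r| <= complex.Re `|c| ^+ r) ->
  0 < t -> cvgn (series (fun r => p r * coef r * kinetic_mode upsilon lam (b r) t)).
Proof.
move=> pc t0.
exact: (cvg_kinetic_series upsilon_gt0 lam_gt0 b0_gt0 b0_le (coef_cvg pc)).
Qed.

Let cvg_source (p : R^nat) t : (forall r, `|p r| <= complex.Re `|c| ^+ r) ->
  0 < t -> cvgn (series (fun r => p r * coef r * t `^ (b r - 1))).
Proof.
move=> pc t0; apply: normed_cvg; rewrite (_ : [normed series _] =
    series (fun r => `|p r * coef r| * t `^ (b r - 1))); first exact: coef_cvg.
congr series; apply/funext => r /=.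
by rewrite normrM (ger0_norm (powR_ge0 _ _)).
Qed.

Lemma kstruve_series t : 0 < t -> cvgn (series (kstruve_term k l c t)) /\
  kstruve k l c t = source pr t +i* source pi t.
Proof.
move=> t0; rewrite /kstruve /source.
have := @limn_series_complex _ (kstruve_term k l c t).
rewrite (_ : (fun n => complex.Re _) = (fun r => pr r * coef r * t `^ (b r - 1))).
  rewrite (_ : (fun n => complex.Im _) = (fun r => pi r * coef r * t `^ (b r - 1))).
    by apply; exact: cvg_source.
  by apply/funext => r; rewrite kstruve_termE// Im_mulC mulrA.
by apply/funext => r; rewrite kstruve_termE// Re_mulC mulrA.
Qed.

Lemma solution_series t : 0 < t ->
  cvgn (series (solution_term k d upsilon l c t)) /\
  limn (series (solution_term k d upsilon l c t)) = solution pr t +i* solution pi t.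
Proof.
move=> t0; rewrite /solution.
have := @limn_series_complex _ (solution_term k d upsilon l c t).
rewrite (_ : (fun n => complex.Re _) =
    (fun r => pr r * coef r * kinetic_mode upsilon lam (b r) t)).
  rewrite (_ : (fun n => complex.Im _) =
      (fun r => pi r * coef r * kinetic_mode upsilon lam (b r) t)).
    by apply; exact: cvg_solution.
  by apply/funext => r; rewrite solution_termE// Im_mulC mulrA.
by apply/funext => r; rewrite solution_termE// Re_mulC mulrA.
Qed.

(** Multiplication by [N0] mixes real and imaginary parts linearly, so each component is a
    combination of the solutions for [pr] and [pi]. *)
Lemma kinetic_solution_series N0 : kinetic_solution k d upsilon l c N0
  (fun t => N0 * limn (series (solution_term k d upsilon l c t))).
Proof.
apply/kinetic_solutionP; split.
  apply: eq_RL_solution (RL_solution_lin (complex.Re N0) (- complex.Im N0)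
    (solutionP pr_le) (solutionP pi_le)) => t t0.
    by have [_ ->] := kstruve_series t0; rewrite Re_mulE /=; ring.
  by have [_ ->] := solution_series t0; rewrite Re_mulE /=; ring.
apply: eq_RL_solution (RL_solution_lin (complex.Im N0) (complex.Re N0)
  (solutionP pr_le) (solutionP pi_le)) => t t0.
  by have [_ ->] := kstruve_series t0; rewrite Im_mulE /=; ring.
by have [_ ->] := solution_series t0; rewrite Im_mulE /=; ring.
Qed.
End kinetic.

Theorem theorem1 (R : realType) (k d upsilon l : R) (c N0 : R[i])
    (k_gt0 : 0 < k) (d_gt0 : 0 < d) (upsilon_gt0 : 0 < upsilon)
    (l_gt : - (3 / 2 * k) < l) :
  (forall t : R, 0 < t ->
     [/\ cvgn (series (kstruve_term k l c t)),
         (forall r : nat, cvgn (series (mittag_leffler_term upsilon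
            (2 * r%:R + l / k + 2) (- (d `^ upsilon * t `^ upsilon))))) &
         cvgn (series (solution_term k d upsilon l c t))]) /\
  (forall N : R -> R[i],
     kinetic_solution k d upsilon l c N0 N <->
     (forall t : R, 0 < t ->
        N t = N0 * limn (series (solution_term k d upsilon l c t)))).
Proof.
split.
  move=> t t0; split.
  - by have [] := kstruve_series c k_gt0 l_gt t0.
  - move=> r; apply: cvg_series_mittag_leffler => //.
    have lk : - (3 / 2) < l / k by rewrite ltr_pdivlMr// mulNr.
    have : 0 <= r%:R :> R by [].
    lra.
  - by have [] := solution_series c k_gt0 d_gt0 upsilon_gt0 l_gt t0.
(* The explicit series is one solution: uniqueness in each component gives one direction, and
   insensitivity to values off the positive half-line the other. *)
move=> N; have /kinetic_solutionP[Sr Si] :=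
  kinetic_solution_series c k_gt0 d_gt0 upsilon_gt0 l_gt N0.
split.
  move=> /kinetic_solutionP[Nr Ni] t t0; apply/eqP; rewrite eq_complex.
  by rewrite (RL_solution_unique upsilon_gt0 Nr Sr t0)
             (RL_solution_unique upsilon_gt0 Ni Si t0) !eqxx.
move=> NE; apply/kinetic_solutionP; split.
  by apply: eq_RL_solution Sr => // t t0; rewrite NE.
by apply: eq_RL_solution Si => // t t0; rewrite NE.
Qed.
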